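(* Let $n\ge 1$ and let $u:\mathbb{R}^n\to\mathbb{R}$ be a $C^2$ function satisfying $$-\sqrt{2}\sum_{i=1}^n\frac{1}{1+\lambda_i(x)}=-u(x)+\frac12\langle x,Du(x)\rangle,\qquad x\in\mathbb{R}^n,$$ where $\lambda_1(x),\dots,\lambda_n(x)$ are the eigenvalues of the Hessian $D^2u(x)$. Assume that either $D^2u(x)>-I$ for all $x\in\mathbb{R}^n$, or $D^2u(x)<-I$ for all $x\in\mathbb{R}^n$. Then $u$ is a quadratic polynomial. Furthermore, there exists a symmetric real $n\times n$ matrix $A$ such that $$u(x)=\sqrt{2}\sum_{i=1}^n\frac{1}{1+\bar\lambda_i}+\frac12\langle x,Ax\rangle\qquad\text{for all }x\in\mathbb{R}^n,$$ where $\bar\lambda_1,\dots,\bar\lambda_n$ are the eigenvalues of $A$.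
   Context: $\langle\cdot,\cdot\rangle$ is the standard inner product on $\mathbb{R}^n$, $Du$ is the gradient, $I$ is the identity matrix, and inequalities between symmetric matrices are in the sense of quadratic forms (strict inequality means the difference is positive definite). ''Quadratic polynomial'' means a polynomial of degree at most $2$. *)

(* Defs.v *)
From HB Require Import structures.
From mathcomp Require Import all_boot all_order all_algebra.
From mathcomp Require mpoly.

Set Implicit Arguments.
Unset Strict Implicit.
Unset Printing Implicit Defensive.

(* mpoly is imported only inside this module, and before the analysis library:
   the notations of the two libraries clash. *)
Module MPolyFun.
Import mpoly.
Local Open Scope ring_scope.

(* [msize p] is the total degree of p plus one (0 for p = 0). *)
Definition quadratic_polynomial (R : comNzRingType) (n : nat)
  (f : 'rV[R]_n -> R) : Prop :=
  exists p : {mpoly R[n]}, (msize p <= 3)%N /\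
    forall x : 'rV[R]_n, f x = p.@[fun i => x 0 i].

End MPolyFun.

Notation quadratic_polynomial := MPolyFun.quadratic_polynomial.

From mathcomp Require Import all_classical all_reals all_analysis.

Import Order.TTheory GRing.Theory Num.Theory.
Import numFieldNormedType.Exports.
Local Open Scope ring_scope.

(* Vectors of R^n are row vectors, so "A x" is written [x *m A^T]. *)
Definition dotv (R : realType) (n : nat) (x y : 'rV[R]_n) : R :=
  \sum_(i < n) x 0 i * y 0 i.

Definition qform (R : realType) (n : nat) (A : 'M[R]_n) (x : 'rV[R]_n) : R :=
  dotv x (x *m A^T).

(* The difference B - A is positive definite as a quadratic form. *)
Definition loewner_lt (R : realType) (n : nat) (A B : 'M[R]_n) : Prop :=
  forall v : 'rV[R]_n, v != 0 -> 0 < qform (B - A) v.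

Definition partial (R : realType) (n : nat) (i : 'I_n) (f : 'rV[R]_n -> R) :
  'rV[R]_n -> R := fun x => 'D_(delta_mx 0 i) f x.

Definition grad (R : realType) (n : nat) (f : 'rV[R]_n -> R) (x : 'rV[R]_n) :
  'rV[R]_n := \row_(i < n) partial i f x.

Definition hessian (R : realType) (n : nat) (f : 'rV[R]_n -> R)
  (x : 'rV[R]_n) : 'M[R]_n :=
  \matrix_(i < n, j < n) partial i (partial j f) x.

(* C^k on R^n: all iterated partial derivatives of order at most k exist
   everywhere and are continuous. *)
Fixpoint is_Ck (R : realType) (n : nat) (k : nat) (f : 'rV[R]_n -> R) : Prop :=
  continuous f /\
  if k is k'.+1 then
    forall i : 'I_n, (forall x : 'rV[R]_n, derivable f x (delta_mx 0 i)) /\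
                     is_Ck k' (partial i f)
  else True.

(* l lists the eigenvalues of A, repeated with algebraic multiplicity. *)
Definition eigenvalues_of (R : realType) (n : nat) (A : 'M[R]_n)
  (l : 'I_n -> R) : Prop :=
  char_poly A = \prod_(i < n) ('X - (l i)%:P).

(* Main.v *)
(* With w = u + |x|^2/2 (or its opposite, in the second case), y = Dw and
   H = D^2 w > 0, the equation reads phi := w - <x, y>/2 = s tr(H^-1), s = sqrt 2,
   and it suffices to show that phi is constant: w - phi is then homogeneous of
   degree 2 and C^2 at the origin.

   For l > 1 let q(x, l) = (l^2 w(x) - w(l x)) / (l^2 - 1).  By the mean value theorem
   q(x, l) = phi(t x) for some t in (1, l), so q >= 0 and q tends to phi as l -> 1.
   Let M g = s tr(H^-2 D^2 g) - <x, Dg>/2.  Convexity of C |-> tr(C^-1), applied to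
   H(x) and H(l x), gives M q <= l (l^2 - 1)/2 d_l q: thus q is a nonnegative
   supersolution of a parabolic equation whose time variable tends to -oo as l -> 1.
   As in the proof that positive superharmonic functions of a recurrent diffusion are
   constant, phi(x) >= phi(a) follows for all x and a by comparing q with a function b
   that tends to -oo at infinity and satisfies M b > 0 off a small ball around a.  One
   takes b = K exp(- al rho) - w, where rho is the Bregman distance of w to a: indeed
   M(- w) = <x, y> - w is the Legendre transform of w at y, which is coercive.  Only
   second derivatives of w are ever used. *)
Require Import Defs.
From mathcomp Require Import all_boot all_order all_algebra.
From mathcomp Require mpoly.

Set Implicit Arguments.
Unset Strict Implicit.
Unset Printing Implicit Defensive.

(* The notations of multinomials clash with those of mathcomp-analysis, imported below. *)
Module QuadraticForms.
Import GRing.Theory mpoly.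
Local Open Scope ring_scope.

Lemma quadratic_polynomial_form (R : comNzRingType) n (c : R) (A : 'M[R]_n) :
  quadratic_polynomial (fun x : 'rV[R]_n =>
    c + \sum_(i < n) \sum_(j < n) x 0 i * A i j * x 0 j).
Proof.
exists (c%:MP + \sum_(i < n) \sum_(j < n) A i j *: ('X_i * 'X_j)); split=> [|x].
  rewrite (leq_trans (msizeD_le _ _)) // geq_max msizeC.
  rewrite (leq_trans (leq_b1 _)) //=.
  apply: leq_trans (msize_sum _ _ _) _; apply/bigmax_leqP => i _.
  apply: leq_trans (msize_sum _ _ _) _; apply/bigmax_leqP => j _.
  apply: leq_trans (msizeZ_le _ _) _; rewrite -mpolyXD msizeX.
  by rewrite mdegD !mdeg1.
rewrite mevalD mevalC; congr (_ + _); rewrite rmorph_sum /=.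
apply: eq_bigr => i _; rewrite rmorph_sum /=; apply: eq_bigr => j _.
by rewrite mevalZ mevalM !mevalXU mulrCA mulrA.
Qed.

End QuadraticForms.

From mathcomp Require Import all_classical all_reals all_analysis.
From mathcomp Require Import ring lra.
Import Order.TTheory GRing.Theory Num.Theory.
Import numFieldNormedType.Exports.
Local Open Scope ring_scope.
Local Open Scope classical_set_scope.

(** * Dot product, quadratic forms and traces *)

Section DotProduct.
Context {R : realType} {n : nat}.
Implicit Types (x y z : 'rV[R]_n) (A : 'M[R]_n).

Lemma dotvE x y : dotv x y = (x *m y^T) 0 0.
Proof. by rewrite mxE; apply: eq_bigr => i _; rewrite mxE. Qed.

Lemma dotvC x y : dotv x y = dotv y x.
Proof. by apply: eq_bigr => i _; rewrite mulrC. Qed.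

Lemma dotvDr x y z : dotv x (y + z) = dotv x y + dotv x z.
Proof. by rewrite -big_split; apply: eq_bigr => i _; rewrite mxE mulrDr. Qed.

Lemma dotvZr a x y : dotv x (a *: y) = a * dotv x y.
Proof. by rewrite mulr_sumr; apply: eq_bigr => i _; rewrite mxE mulrCA. Qed.

Lemma dotvNr x y : dotv x (- y) = - dotv x y.
Proof. by rewrite -scaleN1r dotvZr mulN1r. Qed.

Lemma dotvBr x y z : dotv x (y - z) = dotv x y - dotv x z.
Proof. by rewrite dotvDr dotvNr. Qed.

Lemma dotv0r x : dotv x 0 = 0.
Proof. by rewrite -(scale0r 0) dotvZr mul0r. Qed.

Lemma dotvDl x y z : dotv (y + z) x = dotv y x + dotv z x.
Proof. by rewrite !(dotvC _ x) dotvDr. Qed.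

Lemma dotvZl a x y : dotv (a *: y) x = a * dotv y x.
Proof. by rewrite !(dotvC _ x) dotvZr. Qed.

Lemma dotvNl x y : dotv (- y) x = - dotv y x.
Proof. by rewrite !(dotvC _ x) dotvNr. Qed.

Lemma dotvBl x y z : dotv (y - z) x = dotv y x - dotv z x.
Proof. by rewrite dotvDl dotvNl. Qed.

Lemma dotv0l x : dotv 0 x = 0.
Proof. by rewrite dotvC dotv0r. Qed.

Lemma dotv_ge0 x : 0 <= dotv x x.
Proof. by apply: sumr_ge0 => i _; rewrite -expr2 sqr_ge0. Qed.

Lemma dotv_eq0 x : (dotv x x == 0) = (x == 0).
Proof.
apply/idP/eqP => [|->]; last by rewrite dotv0r.
rewrite psumr_eq0 => [/allP h|i _]; last by rewrite -expr2 sqr_ge0.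
apply/rowP => i; rewrite mxE; apply/eqP.
by have := h i (mem_index_enum i); rewrite mulf_eq0 orbb.
Qed.

Lemma dotv_gt0 x : (0 < dotv x x) = (x != 0).
Proof. by rewrite lt_def dotv_eq0 dotv_ge0 andbT. Qed.

Lemma dotv_CauchySchwarz x y : dotv x y ^+ 2 <= dotv x x * dotv y y.
Proof.
have [->|x0] := eqVneq x 0; first by rewrite !dotv0l expr2 !mul0r.
have xx : 0 < dotv x x by rewrite dotv_gt0.
(* This square expands to [dotv x x] times the difference of the two sides. *)
have := dotv_ge0 (dotv x x *: y - dotv x y *: x).
rewrite !(dotvBl, dotvBr, dotvZl, dotvZr) (dotvC y x) => h.
rewrite -subr_ge0 -(pmulr_rge0 _ xx).
by rewrite (le_trans h)// le_eqVlt; apply/orP; left; apply/eqP; ring.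
Qed.

Lemma qformE A x : qform A x = (x *m A *m x^T) 0 0.
Proof. by rewrite /qform dotvE trmx_mul trmxK mulmxA. Qed.

Lemma qform0 A : qform A 0 = 0. Proof. by rewrite /qform dotv0l. Qed.

Lemma qformD A B x : qform (A + B) x = qform A x + qform B x.
Proof. by rewrite !qformE mulmxDr mulmxDl mxE. Qed.

Lemma qformZ A a x : qform (a *: A) x = a * qform A x.
Proof. by rewrite !qformE -scalemxAr -scalemxAl mxE. Qed.

Lemma qformN A x : qform (- A) x = - qform A x.
Proof. by rewrite -scaleN1r qformZ mulN1r. Qed.

Lemma qform1 x : qform 1%:M x = dotv x x.
Proof. by rewrite /qform trmx1 mulmx1. Qed.

Lemma qform_outer x y : qform (x^T *m x) y = dotv x y ^+ 2.
Proof.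
rewrite qformE mulmxA -mulmxA mxE big_ord1 expr2.
by congr (_ * _); rewrite -dotvE // dotvC.
Qed.

Lemma qform_sum A x : qform A x = \sum_i \sum_j x 0 i * A i j * x 0 j.
Proof.
rewrite /qform /dotv; apply: eq_bigr => i _.
by rewrite mxE mulr_sumr; apply: eq_bigr => j _; rewrite mxE; ring.
Qed.

Lemma mxtrace_outer x : \tr (x^T *m x) = dotv x x.
Proof. by rewrite mxtrace_mulC /mxtrace big_ord1 dotvE. Qed.

(** The diagonal entries are the values of the quadratic form of [A] at the rows of [Y]. *)
Lemma mxtrace_congr_ge0 A (Y : 'M[R]_n) : (forall v, 0 <= qform A v) ->
  0 <= \tr (Y *m A *m Y^T).
Proof.
move=> A0; apply: sumr_ge0 => i _.
have -> : (Y *m A *m Y^T) i i = qform A (row i Y); last exact: A0.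
by rewrite qformE tr_row -row_mul !mxE; apply: eq_bigr => j _; rewrite !mxE.
Qed.

Definition posdef A := forall v, v != 0 -> 0 < qform A v.

Lemma posdef_ge0 A v : posdef A -> 0 <= qform A v.
Proof.
by move=> pA; have [->|/pA/ltW//] := eqVneq v 0; rewrite qform0.
Qed.

Lemma posdef_unit A : posdef A -> A \in unitmx.
Proof.
move=> pA; rewrite unitmxE unitfE; apply/negP => /det0P[v v0 vA].
by have := pA v v0; rewrite qformE vA mul0mx mxE ltxx.
Qed.

(** Tangent inequality at [A] for the convex function C |-> tr(C^-1), obtained by expanding tr((B^-1
    - A^-1) B (B^-1 - A^-1)) >= 0. *)
Lemma mxtrace_inv_convex A B : A^T = A -> B^T = B -> posdef A -> posdef B ->
  2 * \tr (invmx A) <= \tr (invmx B) + \tr (invmx A *m B *m invmx A).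
Proof.
move=> At Bt pA pB.
have uA := posdef_unit pA; have uB := posdef_unit pB.
have At' : (invmx A)^T = invmx A by rewrite trmx_inv At.
have Bt' : (invmx B)^T = invmx B by rewrite trmx_inv Bt.
have := mxtrace_congr_ge0 (invmx B - invmx A) (fun v => posdef_ge0 v pB).
rewrite linearB /= At' Bt' mulmxBl mulVmx // mulmxBr !mulmxBl !mul1mx.
rewrite -[_ *m B *m invmx B]mulmxA mulmxV // mulmx1 !linearB /=.
lra.
Qed.

(** For nonzero x, the matrix Z = A^-1 - x^T x / [qform A x] satisfies Z A Z^T = Z, so its trace is
    nonnegative. *)
Lemma dotv_le_qform_trace A x : A^T = A -> posdef A ->
  dotv x x <= qform A x * \tr (invmx A).
Proof.
move=> At pA; have [->|x0] := eqVneq x 0.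
  by rewrite qform0 dotv0l mul0r.
have uA := posdef_unit pA; have q0 := pA x x0.
have At' : (invmx A)^T = invmx A by rewrite trmx_inv At.
have q0' : qform A x != 0 by rewrite gt_eqF.
have := mxtrace_congr_ge0 (invmx A - (qform A x)^-1 *: (x^T *m x))
  (fun v => posdef_ge0 v pA).
have -> : (invmx A - (qform A x)^-1 *: (x^T *m x)) *m A *m
    (invmx A - (qform A x)^-1 *: (x^T *m x))^T =
    invmx A - (qform A x)^-1 *: (x^T *m x).
  have Xt : (x^T *m x)^T = x^T *m x by rewrite trmx_mul trmxK.
  have -> : (invmx A - (qform A x)^-1 *: (x^T *m x))^T =
    invmx A - (qform A x)^-1 *: (x^T *m x) by rewrite linearB linearZ /= Xt At'.
  rewrite mulmxBl -scalemxAl mulVmx // mulmxBr.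
  rewrite !mulmxBl !mul1mx -!scalemxAl -!scalemxAr.
  rewrite -[x^T *m x *m A *m invmx A]mulmxA mulmxV // mulmx1.
  have -> : x^T *m x *m A *m (x^T *m x) = qform A x *: (x^T *m x).
    rewrite -!mulmxA [x *m (A *m _)]mulmxA [_ *m (x^T *m x)]mulmxA.
    rewrite [x *m A *m x^T]mx11_scalar -qformE mul_scalar_mx.
    by rewrite -scalemxAr.
  by rewrite [(qform A x)^-1 *: (qform A x *: _)]scalerA mulVf // scale1r subrr subr0.
rewrite linearB linearZ /= mxtrace_outer subr_ge0.
by rewrite ler_pdivrMl.
Qed.

(** Cauchy-Schwarz on each column. Applied to the product of p H^-1 with H, it bounds |p H^-1| from
    below in terms of |p| and the entries of H. *)
Lemma dotv_mulmx_le A x :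
  dotv (x *m A) (x *m A) <= dotv x x * \sum_i \sum_j A j i ^+ 2.
Proof.
rewrite /dotv [leRHS]mulr_sumr; apply: ler_sum => i _.
have -> : (x *m A) 0 i = dotv x (col i A)^T.
  by rewrite mxE; apply: eq_bigr => j _; rewrite !mxE.
rewrite -expr2 (le_trans (dotv_CauchySchwarz _ _)) //.
rewrite -/(dotv x x); apply: ler_wpM2l; first exact: dotv_ge0.
by rewrite le_eqVlt; apply/orP; left; apply/eqP; apply: eq_bigr => j _; rewrite !mxE.
Qed.

Lemma char_poly_horner A t : (char_poly A).[t] = \det (t%:M - A).
Proof.
rewrite -horner_evalE -det_map_mx; congr (\det _).
by apply/matrixP => i j; rewrite !mxE /= horner_evalE !(hornerE, hornerMn).
Qed.

(** The characteristic polynomial of A^-1 is deduced from that of A, and the trace is read off its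
    subleading coefficient. *)
Lemma mxtrace_invmx A (mu : 'I_n -> R) : (0 < n)%N -> A \in unitmx ->
  (forall t, \det (t%:M - A) = \prod_i (t - mu i)) ->
  \tr (invmx A) = \sum_i (mu i)^-1.
Proof.
move=> n0 uA detA_t.
have detA : \det A = \prod_i mu i.
  have := detA_t 0; rewrite raddf0 sub0r -scaleN1r detZ.
  under eq_bigr do rewrite sub0r -mulN1r.
  rewrite big_split /= prodr_const card_ord => /mulfI -> //.
  by rewrite expf_neq0 // oppr_eq0 oner_eq0.
have mu0 i : mu i != 0.
  by move: uA; rewrite unitmxE unitfE detA => /prodf_neq0; exact.
have cAi : char_poly (invmx A) = \prod_(i < n) ('X - ((mu i)^-1)%:P).
  apply/eqP; rewrite -subr_eq0; apply/eqP.
  set p := _ - _.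
  (* The two polynomials are compared at 1, ..., [size p]: these points are nonzero, so the
     hypothesis can be used at 1/t, and they are too many to be roots of a nonzero difference. *)
  pose s := [seq (i.+1%:R : R) | i <- iota 0 (size p)].
  apply: (@roots_geq_poly_eq0 _ p s); last by rewrite size_map size_iota.
    apply/allP => _ /mapP[i _ ->]; apply/rootP.
    set t := i.+1%:R; have t0 : t != 0 :> R by rewrite pnatr_eq0.
    rewrite /p hornerD hornerN char_poly_horner horner_prod.
    have -> : t%:M - invmx A = (- t) *: (invmx A *m (t^-1%:M - A)).
      rewrite mulmxBr mulVmx // mul_mx_scalar scalerBr scalerA mulNr divff //.
      by rewrite scaleN1r scaleNr opprK scalemx1 addrC.
    rewrite detZ det_mulmx det_inv detA detA_t.
    rewrite -prodfV -!big_split /= -[n in _ ^+ n]card_ord -prodr_const -big_split.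
    apply/eqP; rewrite subr_eq0; apply/eqP; apply: eq_bigr => j _ /=.
    rewrite hornerXsubC; clearbody t; move: (mu j) (mu0 j) => m m0.
    by field; apply/andP.
  rewrite map_inj_uniq ?iota_uniq // => a b /eqP.
  by rewrite eqr_nat => /eqP[].
have := char_poly_trace (invmx A) n0; rewrite cAi => /eqP.
have -> : \prod_(i < n) ('X - ((mu i)^-1)%:P) =
  \prod_(a <- [seq (mu i)^-1 | i <- enum 'I_n]) ('X - a%:P).
  by rewrite big_map big_enum.
have sz : size [seq (mu i)^-1 | i <- enum 'I_n] = n by rewrite size_map size_enum_ord.
have := @coefPn_prod_XsubC R [seq (mu i)^-1 | i <- enum 'I_n].
rewrite sz => ->; last by rewrite -lt0n.
by rewrite eqr_opp big_map big_enum /= => /eqP ->.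
Qed.

End DotProduct.

(** * Directional derivatives *)

Section Directional.
Context {R : realType}.

Lemma is_derive_continuous (g : R -> R) (x d : R) : is_derive x 1 g d ->
  {for x, continuous g}.
Proof.
by move=> [dg _]; apply/differentiable_continuous/derivable1_diffP.
Qed.

(** [b] may lie on either side of [a], so the intermediate point is located by its distance to
    [a]. *)
Lemma MVT_dist (g dg : R -> R) : (forall t : R, is_derive t 1 g (dg t)) ->
  forall a b : R, exists2 c, `|c - a| <= `|b - a| & g b - g a = dg c * (b - a).
Proof.
move=> g' a b; have gc : continuous g by move=> t; exact: is_derive_continuous (g' t).
have [ab|/ltW ba] := leP a b.
  have [|c] := MVT_segment ab (fun t _ => g' t); first exact: continuous_subspaceT.
  rewrite in_itv /= => /andP[ac cb] e; exists c => //.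
  by rewrite !ger0_norm ?subr_ge0 // lerD2r.
have [|c] := MVT_segment ba (fun t _ => g' t); first exact: continuous_subspaceT.
rewrite in_itv /= => /andP[ac cb] e; exists c; last first.
  by rewrite -opprB e -mulrN opprB.
by rewrite !ler0_norm ?subr_le0 // lerN2 lerD2r.
Qed.

Context {V : normedModType R}.
Implicit Types (f : V -> R) (x v e : V).

Lemma is_derive_line f x v t d :
  is_derive (x + t *: v) v f d -> is_derive t 1 (fun s : R => f (x + s *: v)) d.
Proof.
move=> [df <-].
have E : (fun h : R => h^-1 *: (((fun s : R => f (x + s *: v)) \o shift t) (h *: 1) -
    f (x + t *: v))) =
  (fun h : R => h^-1 *: ((f \o shift (x + t *: v)) (h *: v) - f (x + t *: v))).
  apply/funext => h /=; congr (_ *: (f _ - _)).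
  by rewrite scalerDl addrCA [h *: 1]mulr1.
by split; rewrite /derivable /derive E.
Qed.

(** The increment is split into a step h v followed by a step h c e. The mean value theorem turns
    the second into h c D at a point that tends to x, where D is continuous. *)
Lemma is_derive_add_dir f x v e d (D : V -> R) c :
  is_derive x v f d -> (forall y, is_derive y e f (D y)) ->
  {for x, continuous D} -> is_derive x (v + c *: e) f (d + c * D x).
Proof.
move=> [fv fvd] fe Dc.
suff H : (fun h : R => h^-1 *: ((f \o shift x) (h *: (v + c *: e)) - f x)) @ 0^' -->
    (d + c * D x : R).
  split; first by apply/cvg_ex; exists (d + c * D x).
  exact: cvg_lim H.
pose g1 := fun h : R => h^-1 *: ((f \o shift x) (h *: v) - f x).
pose g2 := fun h : R => h^-1 *: (f (h *: (v + c *: e) + x) - f (h *: v + x)).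
have -> : (fun h : R => h^-1 *: ((f \o shift x) (h *: (v + c *: e)) - f x)) = g1 \+ g2.
  apply/funext => h; rewrite /g1 /g2 /= -scalerDr; congr (_ *: _); ring.
apply: cvgD; first by rewrite -fvd; exact: fv.
apply/cvgrPdist_le => /= eps eps0.
pose eps' := eps / (`|c| + 1).
have eps'0 : 0 < eps' by rewrite divr_gt0 // ltr_wpDl.
move/cvgrPdist_le : (Dc) => /(_ _ eps'0) /nbhs_ballP[r /= r0 Hr].
pose K := `|v| + `|c| * `|e| + 1.
have K0 : 0 < K by rewrite ltr_wpDl // addr_ge0 // mulr_ge0.
near=> h.
have h0 : h != 0 by near: h; exact: nbhs_dnbhs_neq.
have hK : `|h| < r / K.
  near: h; apply: dnbhs0_lt; exact: divr_gt0.
have [|s hs es] := @MVT_dist (fun s : R => f (h *: v + x + s *: e))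
   (fun s => D (h *: v + x + s *: e)) _ 0 (h * c).
  by move=> t; apply: is_derive_line.
rewrite /g2 (_ : h *: (v + c *: e) + x = h *: v + x + (h * c) *: e); last first.
  by rewrite scalerDr scalerA addrAC.
move: es; rewrite scale0r addr0 subr0 => ->.
rewrite [X in c * D x - X](_ : _ = c * D (h *: v + x + s *: e)); last first.
  by rewrite /GRing.scale /=; field.
rewrite -mulrBr normrM.
have Ds : `|D x - D (h *: v + x + s *: e)| <= eps'.
  apply: Hr; rewrite -ball_normE /= [h *: v + x]addrC -addrA opprD addrA subrr add0r.
  rewrite normrN; apply: (le_lt_trans (ler_normD _ _)); rewrite !normrZ.
  apply: (@le_lt_trans _ _ (`|h| * K)); last by rewrite -ltr_pdivlMr.
  rewrite /K !mulrDr mulr1 -addrA lerD2l ler_wpDr //.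
  by rewrite mulrA -normrM ler_wpM2r // -[s]subr0 -[h * c]subr0.
apply: (le_trans (ler_wpM2l (normr_ge0 c) Ds)).
rewrite /eps' mulrCA -[leRHS]mulr1 ler_wpM2l //; first exact: ltW.
by rewrite ler_pdivrMr ?mul1r ?lerDl // ltr_wpDl.
Unshelve. all: by end_near. Qed.

(** Schwarz's theorem: two applications of the mean value theorem to the second difference of [f],
    in either order, give h^2 [A] at one point and h^2 [B] at another, both close to x. *)
Lemma mixed_derive_eq f (De De' A B : V -> R) x e e' :
  (forall y, is_derive y e f (De y)) -> (forall y, is_derive y e' f (De' y)) ->
  (forall y, is_derive y e De' (A y)) -> (forall y, is_derive y e' De (B y)) ->
  {for x, continuous A} -> {for x, continuous B} -> A x = B x.
Proof.
move=> fe fe' Ae Be' Ac Bc.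
pose Q h := f (x + h *: e + h *: e') - f (x + h *: e) - (f (x + h *: e') - f x).
have step u u' (Du Du' C : V -> R) h : (forall y, is_derive y u' f (Du' y)) ->
    (forall y, is_derive y u Du' (C y)) ->
    exists s s' : R, [/\ `|s| <= `|h|, `|s'| <= `|h| &
     f (x + h *: u + h *: u') - f (x + h *: u) - (f (x + h *: u') - f x) =
     h ^+ 2 * C (x + s *: u' + s' *: u)].
  move=> fu' Cu.
  have [|s hs es] := @MVT_dist (fun s : R => f (x + h *: u + s *: u') - f (x + s *: u'))
     (fun s => Du' (x + h *: u + s *: u') - Du' (x + s *: u')) _ 0 h.
    by move=> t; apply: is_deriveB; apply: is_derive_line.
  have [|s' hs' es'] := @MVT_dist (fun t : R => Du' (x + s *: u' + t *: u))
     (fun t => C (x + s *: u' + t *: u)) _ 0 h.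
    by move=> t; apply: is_derive_line.
  rewrite !subr0 in hs hs' es es'.
  exists s, s'; split => //.
  move: es es'; rewrite !scale0r !addr0 => es es'.
  rewrite [X in Du' X - _](_ : _ = x + s *: u' + h *: u) in es; last by rewrite addrAC.
  rewrite es' in es.
  transitivity (f (x + h *: u + h *: u') - f (x + h *: u') - (f (x + h *: u) - f x)).
    by ring.
  by rewrite es expr2; ring.
apply/eqP; rewrite -subr_eq0 -normr_le0; apply/ler_addgt0Pl => eps eps0.
rewrite addr0.
have eps20 : 0 < eps / 2 by rewrite divr_gt0.
move/cvgrPdist_le : (Ac) => /(_ _ eps20) /nbhs_ballP[r /= r0 Hr].
move/cvgrPdist_le : (Bc) => /(_ _ eps20) /nbhs_ballP[r' /= r'0 Hr'].
pose K := `|e| + `|e'| + 1.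
have K0 : 0 < K by rewrite ltr_wpDl // addr_ge0.
pose m := Num.min r r'.
have m0 : 0 < m by rewrite lt_min r0.
(* Small enough that all intermediate points stay within both continuity radii: h K = m / 2. *)
pose h := m / (2 * K).
have h0 : 0 < h by rewrite divr_gt0 // mulr_gt0.
have near_x s s' : `|s| <= `|h| -> `|s'| <= `|h| -> `|s *: e' + s' *: e| < m.
  move=> hs hs'; apply: (le_lt_trans (ler_normD _ _)); rewrite !normrZ.
  rewrite (gtr0_norm h0) in hs hs'.
  apply: (@le_lt_trans _ _ (h * K)).
    have := ler_wpM2r (normr_ge0 e') hs; have := ler_wpM2r (normr_ge0 e) hs'.
    by rewrite /K; lra.
  rewrite /h invfM mulrA -mulrA mulVf ?gt_eqF // mulr1.
  by rewrite ltr_pdivrMr // mulr_natr mulr2n ltrDl.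
have [s [s' [hs hs' es]]] := step e e' De De' A h fe' Ae.
have [t [t' [ht ht' et]]] := step e' e De' De B h fe Be'.
have AB : A (x + s *: e' + s' *: e) = B (x + t *: e + t' *: e').
  apply: (@mulfI _ (h ^+ 2)); first by rewrite expf_neq0 // gt_eqF.
  rewrite -es -et [x + h *: e' + h *: e]addrAC.
  by ring.
have dA : `|A x - A (x + s *: e' + s' *: e)| <= eps / 2.
  apply: Hr; rewrite -ball_normE /= -addrA opprD addrA subrr add0r normrN.
  by rewrite (lt_le_trans (near_x _ _ hs hs')) // ge_min lexx.
have dB : `|B x - B (x + t *: e + t' *: e')| <= eps / 2.
  apply: Hr'; rewrite -ball_normE /= -addrA opprD addrA subrr add0r normrN addrC.
  by rewrite (lt_le_trans (near_x _ _ ht' ht)) // ge_min lexx orbT.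
rewrite -AB distrC in dB.
have -> : A x - B x = (A x - A (x + s *: e' + s' *: e)) +
  (A (x + s *: e' + s' *: e) - B x) by ring.
by rewrite (le_trans (ler_normD _ _)) // [leRHS]splitr lerD.
Qed.

End Directional.

Section Rows.
Context {R : realType} {n : nat}.
Implicit Types (f : 'rV[R]_n -> R) (x v : 'rV[R]_n).

(** The coordinates of the direction are added one at a time by [is_derive_add_dir], starting from
    the zero direction. *)
Lemma is_derive_row f (D : 'I_n -> 'rV[R]_n -> R) x v :
  (forall i y, is_derive y (delta_mx 0 i) f (D i y)) ->
  (forall i, continuous (D i)) -> is_derive x v f (\sum_i v 0 i * D i x).
Proof.
move=> fD Dc; rewrite [v in is_derive _ v _ _]row_sum_delta.
elim: (index_enum _) => [|i s IH].
  by rewrite !big_nil; exact: is_derive0.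
by rewrite !big_cons addrC [X in is_derive _ _ _ X]addrC;
  apply: is_derive_add_dir => //; exact: Dc.
Qed.

End Rows.

(** * One variable: mean values and conditions at a minimum *)

Section OneVariable.
Context {R : realType}.
Implicit Types (g dg : R -> R).

Lemma MVT01 g dg : (forall t : R, is_derive t 1 g (dg t)) ->
  exists2 c, 0 < c < 1 & g 1 - g 0 = dg c.
Proof.
move=> g'; have [|c] := MVT ltr01 (fun t _ => g' t).
  by apply: continuous_subspaceT => x; exact: is_derive_continuous (g' x).
by rewrite in_itv /= => c01; rewrite subr0 mulr1 => ->; exists c.
Qed.

(** One-sided, because the minimum in the time variable l may be attained at the right end of its
    interval. *)
Lemma derive_left_min_le0 g (a t d : R) : is_derive t 1 g d -> a < t ->
  (forall s, a < s <= t -> g t <= g s) -> d <= 0.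
Proof.
move=> [dg <-] lt_at gmin.
rewrite ['D_1 g t]cvg_at_leftE; last exact: dg.
apply: limr_le.
  rewrite -(cvg_at_leftE (fun h => h^-1 *: ((g \o shift t) _ - g t))) //.
  apply: cvg_trans dg; apply: cvg_app.
  by move=> A [e egt0 Ae]; exists e => // x xe xgt0; apply: Ae => //; exact/ltr0_neq0.
near=> h; apply: mulr_le0_ge0.
  by rewrite invr_le0; apply: ltW; near: h; exists 1 => /=.
rewrite subr_ge0 [_%:A]mulr1; apply: gmin.
have h0 : h < 0 by near: h; exists 1 => /=.
have hat : `|h| < t - a.
  near: h; exists (t - a); first by rewrite /= subr_gt0.
  by move=> h /=; rewrite distrC subr0.
rewrite ltr0_norm // in hat.
by apply/andP; split; rewrite /=; lra.
Unshelve. all: by end_near. Qed.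

Lemma derive_min_eq0 g (d : R) : is_derive (0 : R) 1 g d -> (forall s, g 0 <= g s) ->
  d = 0.
Proof.
move=> g' gmin; apply/eqP; rewrite eq_le; apply/andP; split.
  by apply: (derive_left_min_le0 g' (ltrN10 _)) => s _.
rewrite -oppr_le0.
have g'N : is_derive (0 : R) 1 (fun s => g (- s)) (- d).
  have := @is_derive1_comp R g (-%R) 0 d (-1).
  by rewrite oppr0 mulrN1; apply.
by apply: (derive_left_min_le0 g'N (ltrN10 _)) => s _; rewrite oppr0.
Qed.

(** If [d] were negative, [dg], which vanishes at 0, would be negative just to the right of 0, and
    [g] would drop below its minimum. *)
Lemma derive2_min_ge0 g dg (d : R) : (forall t : R, is_derive t 1 g (dg t)) ->
  is_derive (0 : R) 1 dg d -> (forall s, g 0 <= g s) -> 0 <= d.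
Proof.
move=> g' dg' gmin; rewrite leNgt; apply/negP => d0.
have dg0 : dg 0 = 0 := derive_min_eq0 (g' 0) gmin.
have : \forall h \near (0 : R)^', h^-1 *: ((dg \o shift 0) (h *: 1) - dg 0) < 0.
  case: dg' => dg1 dg2; apply: (cvgr_lt ('D_1 dg 0)); first exact: dg1.
  by rewrite dg2.
move=> [e /= e0 He].
have e20 : 0 < e / 2 by rewrite divr_gt0.
have [|c] := MVT e20 (fun t _ => g' t).
  by apply: continuous_subspaceT => x; exact: is_derive_continuous (g' x).
rewrite in_itv /= => /andP[c0 ce] E.
have := He c; rewrite /ball /= sub0r normrN gtr0_norm // => /(_ _ _).
rewrite dg0 subr0 addr0 [_%:A]mulr1 => dgc.
have : dg c < 0.
  have : c^-1 * dg c < 0 by apply: dgc; [lra|exact: lt0r_neq0].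
  by rewrite pmulr_rlt0 // invr_gt0.
have := gmin (e / 2); rewrite -subr_ge0 E subr0 pmulr_lge0 // => h1 h2.
by have := le_lt_trans h1 h2; rewrite ltxx.
Qed.

Lemma is_derive_sqr (s : R) : is_derive s 1 (fun t : R => t ^+ 2) (2 * s).
Proof. by apply: is_derive_eq; rewrite /GRing.scale /=; ring. Qed.

End OneVariable.

Lemma continuous_bigsum (R : realType) (T : topologicalType) (I : Type)
  (s : seq I) (F : I -> T -> R) : (forall i, continuous (F i)) ->
  continuous (fun t => \sum_(i <- s) F i t).
Proof.
move=> Fc; elim: s => [|i s IH].
  rewrite (_ : (fun t => _) = cst 0); first exact: cst_continuous.
  by apply/funext => t; rewrite big_nil.
rewrite (_ : (fun t => _) = (fun t => F i t + \sum_(j <- s) F j t)).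
  by move=> t; apply: cvgD; [exact: Fc|exact: IH].
by apply/funext => t; rewrite big_cons.
Qed.

(** * The Euclidean norm and compactness of its balls *)

Section EuclideanNorm.
Context {R : realType} {n : nat}.
Implicit Types (x y v : 'rV[R]_n).

(** The norm that row vectors carry already is the sup norm, hence the separate Euclidean one. *)
Definition enorm x := Num.sqrt (dotv x x).

Lemma enorm_ge0 x : 0 <= enorm x. Proof. exact: sqrtr_ge0. Qed.

Lemma enorm_sqr x : enorm x ^+ 2 = dotv x x.
Proof. by rewrite sqr_sqrtr // dotv_ge0. Qed.

Lemma enormZ a x : enorm (a *: x) = `|a| * enorm x.
Proof.
by rewrite /enorm dotvZl dotvZr mulrA -expr2 sqrtrM ?sqr_ge0 // sqrtr_sqr.
Qed.

Lemma enorm_gt0 x : (0 < enorm x) = (x != 0).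
Proof. by rewrite sqrtr_gt0 dotv_gt0. Qed.

Lemma dotv_le_enorm x y : dotv x y <= enorm x * enorm y.
Proof.
rewrite -sqrtrM ?dotv_ge0 // (le_trans (ler_norm _)) // -sqrtr_sqr.
by rewrite ler_wsqrtr // dotv_CauchySchwarz.
Qed.

Lemma norm_le_enorm x : `|x| <= enorm x.
Proof.
rewrite [leLHS]/Num.Def.normr /= mx_normrE; apply/bigmax_leP; split => [|[i j] _ /=].
  exact: enorm_ge0.
rewrite ord1 -sqrtr_sqr ler_wsqrtr // /dotv (bigD1 j) //= -expr2 lerDl.
by apply: sumr_ge0 => k _; rewrite -expr2 sqr_ge0.
Qed.

Lemma dotv_continuous (T : topologicalType) (f g : T -> 'rV[R]_n) :
  (forall i, continuous (fun t => f t 0 i)) ->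
  (forall i, continuous (fun t => g t 0 i)) ->
  continuous (fun t => dotv (f t) (g t)).
Proof.
move=> fc gc; apply: continuous_bigsum => i t.
by apply: cvgM; [exact: fc|exact: gc].
Qed.

Lemma enorm_continuous : continuous enorm.
Proof.
move=> x; apply: continuous_comp; last exact: sqrt_continuous.
by apply: dotv_continuous => i; exact: coord_continuous.
Qed.

Lemma enorm_ball_compact r : compact [set x | enorm x <= r].
Proof.
apply: bounded_closed_compact.
  exists r; split; first exact: num_real.
  move=> M rM x /= xr; rewrite (le_trans (norm_le_enorm x)) // (le_trans xr) //.
  exact: ltW.
rewrite (_ : [set x | _] = enorm @^-1` [set t | t <= r]) //.
apply: preimage_closed; [by move=> ? _; exact: enorm_continuous|exact: closed_le].
Qed.

End EuclideanNorm.

Lemma compact_bounded_above (T : topologicalType) (R : realType) (A : set T)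
  (f : T -> R) : compact A -> continuous f -> exists M, forall x, A x -> f x <= M.
Proof.
move=> cA cf; have [->|/set0P A0] := eqVneq A set0; first by exists 0.
have [|c _ fc] := compact_EVT_max A0 cA (f := f).
  exact: continuous_subspaceT.
by exists (f c) => x Ax; apply: fc; rewrite inE.
Qed.

Lemma compact_pos_lower_bound (T : topologicalType) (R : realType) (A : set T)
  (f : T -> R) : compact A -> continuous f -> (forall x, A x -> 0 < f x) ->
  exists2 c, 0 < c & forall x, A x -> c <= f x.
Proof.
move=> cA cf f0; have [->|/set0P A0] := eqVneq A set0; first by exists 1.
have [|c cA' fc] := compact_EVT_min A0 cA (f := f).
  exact: continuous_subspaceT.
exists (f c); first by apply: f0; rewrite inE in cA'.
by move=> x Ax; apply: fc; rewrite inE.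
Qed.

(** * The equation for a convex function *)

(* [Dw] and [H] stand for the gradient and the Hessian of [w]; taking them as data lets
   w = u + |x|^2/2 and w = - u - |x|^2/2 be treated together. *)
Record convex_shrinker (R : realType) (n : nat) (sg : R) (w : 'rV[R]_n -> R)
    (Dw : 'rV[R]_n -> 'rV[R]_n) (H : 'rV[R]_n -> 'M[R]_n) : Prop :=
  ConvexShrinker {
  shrinker_gt0 : 0 < sg;
  shrinker_deriv : forall x v, is_derive x v w (dotv v (Dw x));
  shrinker_deriv2 : forall c x v,
    is_derive x v (fun z => dotv c (Dw z)) (dotv c (v *m H x));
  shrinker_cont : continuous w;
  shrinker_grad_cont : forall i, continuous (fun x => Dw x 0 i);
  shrinker_hess_cont : forall i j, continuous (fun x => H x i j);
  shrinker_sym : forall x, (H x)^T = H x;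
  shrinker_posdef : forall x, posdef (H x);
  shrinker_eq : forall x, w x - 1 / 2 * dotv x (Dw x) = sg * \tr (invmx (H x)) }.

Section ConvexShrinker.
Context {R : realType} {n : nat} {sg : R} {w : 'rV[R]_n -> R}.
Context {y : 'rV[R]_n -> 'rV[R]_n} {H : 'rV[R]_n -> 'M[R]_n}.
Context (S : convex_shrinker sg w y H).
Implicit Types (x v a e : 'rV[R]_n).

Let Ht := shrinker_sym S.
Let Hpd := shrinker_posdef S.
Let sg0 := shrinker_gt0 S.

(** The function phi that is to be proved constant; by the equation it equals
    [sg * \tr (invmx (H x))]. *)
Definition support_value x := w x - 1 / 2 * dotv x (y x).
Definition legendre x := dotv x (y x) - w x.

(** * Convexity, growth and coercivity *)

Lemma dotv_hess x v : dotv v (v *m H x) = qform (H x) v.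
Proof. by rewrite /qform Ht. Qed.

Lemma line_deriv x v (t : R) :
  is_derive t 1 (fun s => w (x + s *: v)) (dotv v (y (x + t *: v))).
Proof. by apply: is_derive_line; exact: (shrinker_deriv S). Qed.

Lemma line_deriv2 x v c (t : R) :
  is_derive t 1 (fun s => dotv c (y (x + s *: v))) (dotv c (v *m H (x + t *: v))).
Proof.
apply: (@is_derive_line _ _ (fun z => dotv c (y z))).
exact: (shrinker_deriv2 S).
Qed.

Lemma grad_mono_lt x a : x != a -> 0 < dotv (x - a) (y x - y a).
Proof.
rewrite -subr_eq0 => xa.
have [c _] := MVT01 (line_deriv2 a (x - a) (x - a)).
rewrite scale1r scale0r addr0 [a + (x - a)]addrC subrK -dotvBr => ->.
by rewrite dotv_hess; exact: Hpd.
Qed.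

Lemma grad_mono x a : 0 <= dotv (x - a) (y x - y a).
Proof.
by have [->|/grad_mono_lt/ltW//] := eqVneq x a; rewrite subrr dotv0l.
Qed.

Lemma tangent_le x a : w x + dotv (a - x) (y x) <= w a.
Proof.
have [c /andP[c0 _]] := MVT01 (line_deriv x (a - x)).
rewrite scale1r scale0r addr0 [x + (a - x)]addrC subrK => E.
have := grad_mono (x + c *: (a - x)) x.
rewrite [x + _ - x]addrC addKr dotvZl pmulr_rge0 // dotvBr -E; lra.
Qed.

Lemma mxtrace_inv_hess_ge0 x : 0 <= \tr (invmx (H x)).
Proof.
have := mxtrace_congr_ge0 (invmx (H x)) (fun v => posdef_ge0 v (Hpd x)).
by rewrite mulVmx ?posdef_unit // mul1mx trmx_inv Ht.
Qed.

Lemma support_value_ge0 x : 0 <= support_value x.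
Proof. by rewrite /support_value (shrinker_eq S) mulr_ge0 ?mxtrace_inv_hess_ge0 // ltW. Qed.

Lemma dotv_grad_continuous (f : 'rV[R]_n -> 'rV[R]_n) :
  (forall i, continuous (fun x => f x 0 i)) -> continuous (fun x => dotv (f x) (y x)).
Proof. by move=> fc; apply: dotv_continuous => //; exact: shrinker_grad_cont S. Qed.

Lemma dotvxy_continuous : continuous (fun x => dotv x (y x)).
Proof. by apply: dotv_grad_continuous => i; exact: coord_continuous. Qed.

Lemma legendre_continuous : continuous legendre.
Proof.
rewrite (_ : legendre = (fun x => dotv x (y x)) \- w) // => x.
by apply: continuousB; [exact: dotvxy_continuous|exact: (shrinker_cont S)].
Qed.

Lemma support_value_continuous : continuous support_value.
Proof.
rewrite (_ : support_value = w \- (cst (1 / 2) \* (fun x => dotv x (y x)))) // => x.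
apply: continuousB; first exact: (shrinker_cont S).
by apply: continuousM; [exact: cst_continuous|exact: dotvxy_continuous].
Qed.

(* Along a ray f(t) = w(t e), the equation and Cauchy-Schwarz give
   f'' >= sg |e|^2 / (f - t f' / 2), and f - t f' / 2 grows at most linearly as
   long as f' stays bounded: so f' grows at least like a logarithm. *)
Lemma radial_growth P : exists2 r, 0 < r &
  forall x, r <= enorm x -> P * enorm x <= dotv x (y x).
Proof.
wlog P0 : P / 0 <= P.
  move=> h; have [|r r0 hr] := h (Num.max P 0); first by rewrite le_max lexx orbT.
  exists r => // x rx; apply: le_trans (hr x rx).
  by rewrite ler_wpM2r ?enorm_ge0 // le_max lexx.
have cN : continuous (- (fun x => dotv x (y x))).
  by move=> x; apply: continuousN; exact: dotvxy_continuous.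
have [C1 HC1] := compact_bounded_above (@enorm_ball_compact R n 1) cN.
pose C0 := `|C1| + `|w 0| + 1.
have C00 : 0 < C0 by rewrite ltr_wpDl // addr_ge0.
pose k := sg / (C0 + P).
have k0 : 0 < k by rewrite divr_gt0 // ltr_wpDr.
(* With T = |x| beyond this radius, k ln T >= P + C0, whereas f'(1) >= - C0 and f'(T) < P would give
   f'(T) - f'(1) < P + C0. *)
exists (expR ((P + C0) / k)); first exact: expR_gt0.
move=> x xr; set T := enorm x in xr *.
have T1 : 1 <= T.
  apply: le_trans xr; rewrite -[leLHS]expR0 ler_expR divr_ge0 ?(ltW k0) //.
  by rewrite addr_ge0 // ltW.
have T0 : 0 < T by exact: lt_le_trans T1.
pose e := T^-1 *: x.
have ee : dotv e e = 1.
  by rewrite -enorm_sqr /e enormZ gtr0_norm ?invr_gt0 // mulVf ?gt_eqF // expr1n.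
have e0 : e != 0 by rewrite -dotv_gt0 ee.
have xE : x = T *: e by rewrite scalerA divff ?gt_eqF // scale1r.
rewrite [in dotv x]xE dotvZl mulrC ler_pM2l //.
rewrite leNgt; apply/negP => lt_P.
pose f' t := dotv e (y (0 + t *: e)).
have f'E t : f' t = dotv e (y (t *: e)) by rewrite /f' add0r.
have f'' (t : R) : is_derive t 1 f' (qform (H (0 + t *: e)) e).
  by rewrite -dotv_hess; exact: line_deriv2.
have f'T : f' T < P by rewrite f'E -xE.
have f'1 : - C0 <= f' 1.
  rewrite f'E scale1r.
  have := HC1 e; rewrite /= /enorm ee sqrtr1 lexx => /(_ isT).
  rewrite fctE => h; rewrite -lerN2 opprK (le_trans h) // (le_trans (ler_norm _)) //.
  by rewrite /C0 -addrA lerDl addr_ge0.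
have mono s t : s <= t -> f' s <= f' t.
  rewrite le_eqVlt => /predU1P[->//|st].
  have := grad_mono (t *: e) (s *: e); rewrite -scalerBl dotvZl dotvBr.
  by rewrite pmulr_rge0 ?subr_gt0 // subr_ge0 !f'E.
have low t : 1 <= t -> t <= T -> k / t <= qform (H (0 + t *: e)) e.
  move=> t1 tT; have t0 : 0 < t by exact: lt_le_trans t1.
  set q := qform _ _; have q0 : 0 < q by exact: Hpd.
  have := dotv_le_qform_trace e (Ht (0 + t *: e)) (Hpd _).
  rewrite ee -/q => h1.
  have := shrinker_eq S (0 + t *: e).
  rewrite add0r dotvZl -f'E => h2.
  (* The tangent plane at t e lies below w at 0: w(t e) <= w(0) + t f'(t), so f - t f' / 2 <= w(0) +
     t f' / 2 <= (C0 + P) t. *)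
  have h3 := tangent_le (t *: e) 0.
  rewrite sub0r dotvNl dotvZl -f'E in h3.
  have h4 : f' t <= P by rewrite ltW // (le_lt_trans _ f'T) // mono.
  have h5 : w 0 <= C0.
    by rewrite (le_trans (ler_norm _)) // /C0 -addrA addrCA lerDl addr_ge0.
  have h6 : sg * \tr (invmx (H (t *: e))) <= (C0 + P) * t.
    have : t * f' t <= t * P by rewrite ler_pM2l.
    have : C0 <= C0 * t by rewrite ler_pMr.
    have : 0 <= P * t by rewrite mulr_ge0 // ltW.
    lra.
  rewrite add0r in h1.
  rewrite /k -mulrA -invfM ler_pdivrMr; last by rewrite mulr_gt0 // ltr_wpDr.
  rewrite (le_trans (y := q * (sg * \tr (invmx (H (t *: e)))))) //.
    by rewrite mulrCA ler_pMr.
  by rewrite ler_pM2l.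
(* The bound f'' >= k / t is integrated from 1 to T: f' - k ln does not decrease. *)
have [||c] := @MVT_segment R (fun t => f' t - k * ln t)
    (fun t => qform (H (0 + t *: e)) e - k * t^-1) 1 T T1.
- move=> t; rewrite in_itv /= => /andP[t1 _].
  have ? : 0 < t by exact: lt_trans t1.
  by apply: is_deriveB; apply: is_deriveZ; exact: is_derive1_ln.
- apply: continuous_in_subspaceT => t; rewrite inE /= in_itv /= => /andP[t1 _].
  apply: cvgB; first exact: is_derive_continuous (f'' t).
  by apply: cvgM; [exact: cvg_cst|apply: continuous_ln; exact: lt_le_trans t1].
rewrite in_itv /= => /andP[c1 cT] E.
have : 0 <= f' T - k * ln T - (f' 1 - k * ln 1).
  by rewrite E mulr_ge0 ?subr_ge0 // low.
rewrite ln1 mulr0 subr0 => h.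
have : (P + C0) / k <= ln T by rewrite -[leLHS]expRK ler_ln ?posrE ?expR_gt0.
rewrite ler_pdivrMr // => h'.
lra.
Qed.

(** Outside the ball of radius r, w lies above its tangent plane at the radial projection of x to
    the sphere of radius r, whose radial slope is at least P. *)
Lemma superlinear P : 0 <= P -> exists C, forall x, P * enorm x - C <= w x.
Proof.
move=> P0; have [r r0 hr] := radial_growth P.
have cN : continuous (- w).
  by move=> x; apply: continuousN; exact: (shrinker_cont S).
have [M HM] := compact_bounded_above (@enorm_ball_compact R n r) cN.
exists (P * r + M) => x; have [xr|xr] := leP (enorm x) r.
  have h : P * enorm x <= P * r by rewrite ler_wpM2l.
  by have := HM x xr; rewrite fctE; lra.
have x0 : 0 < enorm x by exact: lt_trans xr.
pose a := (r / enorm x) *: x.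
have ar : enorm a = r.
  by rewrite enormZ ger0_norm ?divr_ge0 ?enorm_ge0 ?ltW // divfK // gt_eqF.
have h1 : - w a <= M by apply: HM; rewrite /= ar.
have h2 := tangent_le a x.
have h3 : P * r <= dotv a (y a) by rewrite -[X in P * X]ar; apply: hr; rewrite ar.
have xa : x - a = (enorm x / r - 1) *: a.
  rewrite scalerBl scale1r scalerA mulrA divfK ?gt_eqF // divff ?gt_eqF //.
  by rewrite scale1r.
rewrite xa dotvZl in h2.
have h4 : 0 <= enorm x / r - 1 by rewrite subr_ge0 ler_pdivlMr // mul1r ltW.
have h5 := ler_wpM2l h4 h3.
have h6 : (enorm x / r - 1) * (P * r) = P * enorm x - P * r.
  by field; rewrite gt_eqF.
lra.
Qed.

(** The Legendre transform at [y x] is at least <a, y x> - w a for every a; take a = x / |x| and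
    apply [radial_growth]. *)
Lemma legendre_coercive M : exists2 r, 0 < r & forall x, r <= enorm x -> M <= legendre x.
Proof.
have [C HC] := compact_bounded_above (@enorm_ball_compact R n 1) (shrinker_cont S).
have [r r0 hr] := radial_growth (M + C).
exists r => // x xr; have x0 : 0 < enorm x by exact: lt_le_trans xr.
pose a := (enorm x)^-1 *: x.
have a1 : enorm a = 1.
  by rewrite enormZ ger0_norm ?invr_ge0 ?enorm_ge0 // mulVf // gt_eqF.
have h1 : w a <= C by apply: HC; rewrite /= a1.
have := tangent_le x a; rewrite dotvBl => h2.
have h3 : M + C <= dotv a (y x).
  by rewrite dotvZl ler_pdivlMl // mulrC; exact: hr.
rewrite /legendre; lra.
Qed.

(** * The Bregman distance and the barrier *)

Definition bregman a x := w x - w a - dotv (x - a) (y a).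

Lemma bregman_ge0 a x : 0 <= bregman a x.
Proof. by have := tangent_le a x; rewrite /bregman; lra. Qed.

(** The slope |y a| + 2 absorbs the linear term. Of the remaining 2 |x|, one half offsets constants
    in [barrier] and the other gives exponential decay. *)
Lemma bregman_superlinear a : exists C, forall x, 2 * enorm x - C <= bregman a x.
Proof.
have [|C HC] := @superlinear (enorm (y a) + 2); first by rewrite addr_ge0 ?enorm_ge0.
exists (C + w a - dotv a (y a)) => x; have := HC x.
have := dotv_le_enorm x (y a).
rewrite /bregman dotvBl; lra.
Qed.

Lemma bregman_continuous a : continuous (bregman a).
Proof.
rewrite (_ : bregman a = (w \- cst (w a)) \- (fun x => dotv (x - a) (cst (y a) x))) // => x.
apply: continuousB.
  by apply: continuousB; [exact: (shrinker_cont S)|exact: cst_continuous].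
apply: dotv_continuous => i; last exact: cst_continuous.
rewrite (_ : (fun t => _) = (fun t : 'rV[R]_n => t 0 i) \- cst (a 0 i)).
  by move=> t; apply: continuousB; [exact: coord_continuous|exact: cst_continuous].
by apply/funext => t; rewrite !mxE.
Qed.

(* [al * (...)] is the value at [K exp(- al rho)], with [rho] the Bregman distance
   to [a], of the operator [sg tr(H^-2 D^2 g) - <x, Dg> / 2], up to the factor
   [K exp(- al rho)]; [legendre x] is its value at [- w]. *)
Lemma barrier a r : 0 < r -> exists al K, [/\ 0 < al, 0 < K & forall x, r <= enorm (x - a) ->
  1 / 2 <= K * expR (- (al * bregman a x)) *
    (al * (legendre x - 1 / 2 * dotv x (y a)) +
     sg * al ^+ 2 * dotv ((y x - y a) *m invmx (H x)) ((y x - y a) *m invmx (H x)))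
    + legendre x].
Proof.
move=> r0.
(* Three regions: for |x| <= R0 the exponential term makes up for small values of [legendre];
   between R0 and R1, where [legendre] is at least 1, it need only be nonnegative; beyond R1 it is
   at least - 1 / 2. *)
have [R0 R00 HR0] := legendre_coercive 1.
have cL : continuous (- legendre).
  by move=> x; apply: continuousN; exact: legendre_continuous.
have [C2' HC2'] := compact_bounded_above (@enorm_ball_compact R n R0) cL.
pose C2 := `|C2'| + 1.
have C21 : 1 <= C2 by rewrite lerDr.
have HC2 x : enorm x <= R0 -> 1 - legendre x <= C2.
  move=> /HC2'; rewrite fctE => h; have := ler_norm C2'; rewrite /C2; lra.
have [s0 Hs0] := compact_bounded_above (@enorm_ball_compact R n R0) (@bregman_continuous a).
have [C3 HC3] := bregman_superlinear a.
pose R1 := R0 + `|C3 + s0| + 1.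
have R1s : C3 + s0 <= R1.
  by have := ler_norm (C3 + s0); rewrite /R1; lra.
have R1_1 : 1 <= R1 by rewrite /R1 lerDr addr_ge0 // ltW.
have R01 : R0 <= R1 by rewrite /R1 -addrA lerDl addr_ge0.
pose p x := y x - y a.
pose g x := legendre x - 1 / 2 * dotv x (y a).
have pc i : continuous (fun x => p x 0 i).
  rewrite (_ : (fun t => _) = (fun t => y t 0 i) \- cst (y a 0 i)).
    by move=> t; apply: continuousB; [exact: (shrinker_grad_cont S)|exact: cst_continuous].
  by apply/funext => t; rewrite !mxE.
have gc : continuous (- g).
  move=> x; apply: continuousN.
  apply: (@continuousB _ _ _ legendre (cst (1 / 2) \* (fun x => dotv x (y a)))).
    exact: legendre_continuous.
  apply: continuousM; first exact: cst_continuous.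
  apply: (@dotv_continuous _ _ _ _ (cst (y a))) => i; first exact: coord_continuous.
  exact: cst_continuous.
have [G' HG'] := compact_bounded_above (@enorm_ball_compact R n R1) gc.
pose G := `|G'|.
have HG x : enorm x <= R1 -> - G <= g x.
  by move=> /HG'; rewrite fctE => h; have := ler_norm G'; rewrite /G; lra.
pose N x := \sum_i \sum_j H x j i ^+ 2.
have N0 x : 0 <= N x by apply: sumr_ge0 => i _; apply: sumr_ge0 => j _; exact: sqr_ge0.
have Nc : continuous N.
  apply: continuous_bigsum => i; apply: continuous_bigsum => j x.
  by apply: (@continuousM _ _ (fun x => H x j i) (fun x => H x j i));
    exact: (shrinker_hess_cont S).
(* A continuous lower bound of |p H^-1|^2, positive away from [a] by strict monotonicity of the
   gradient. *)
pose F x := dotv (p x) (p x) / (1 + N x).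
have Fc : continuous F.
  move=> x.
  apply: (@continuousM _ _ (fun x => dotv (p x) (p x)) (fun x => (1 + N x)^-1)).
    exact: dotv_continuous.
  apply: (@continuousV _ _ (fun x => 1 + N x)); first by rewrite gt_eqF // ltr_wpDr.
  by apply: (@continuousD _ _ _ (fun=> 1 : R) N); [exact: cst_continuous|exact: Nc].
have Acomp : compact [set x | enorm x <= R1 /\ r <= enorm (x - a)].
  apply: (subclosed_compact _ (@enorm_ball_compact R n R1)) => [|x []//].
  apply: closedI.
    apply: (@preimage_closed _ _ enorm [set t | t <= R1]); last exact: closed_le.
    by move=> ? _; exact: enorm_continuous.
  apply: (@preimage_closed _ _ (fun x => enorm (x - a)) [set t | r <= t]);
    last exact: closed_ge.
  move=> x _; apply: (@continuous_comp _ _ _ (fun x => x - a) enorm); last exact: enorm_continuous.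
  by apply: continuousB; [exact: cvg_id|exact: cst_continuous].
have [|c c0 Hc] := compact_pos_lower_bound Acomp Fc.
  move=> x [_ xr]; rewrite divr_gt0 ?ltr_wpDr // dotv_gt0.
  have xa : x != a.
    by rewrite -subr_eq0 -enorm_gt0; exact: lt_le_trans xr.
  have := grad_mono_lt xa; apply: contraTneq.
  by rewrite /p => ->; rewrite dotv0r ltxx.
pose T x := dotv (p x *m invmx (H x)) (p x *m invmx (H x)).
have T0 x : 0 <= T x by exact: dotv_ge0.
have FT x : F x <= T x.
  rewrite /F ler_pdivrMr ?ltr_wpDr //.
  rewrite -[X in dotv X _](mulmxKV (posdef_unit (Hpd x))).
  rewrite -[X in dotv _ X](mulmxKV (posdef_unit (Hpd x))).
  apply: (le_trans (dotv_mulmx_le _ _)); apply: ler_wpM2l; first exact: dotv_ge0.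
  by rewrite -/(N x) lerDr.
(* The fraction gives [sg * al * c] >= G + 1, so the bracket is at least 1 for |x| <= R1; the last
   term controls the contribution of [y a] beyond R1. *)
pose al := 1 + (G + 1) / (sg * c) + 4 * C2 * enorm (y a).
have C20 : 0 < C2 by exact: lt_le_trans C21.
have t1 : 0 <= (G + 1) / (sg * c).
  by rewrite divr_ge0 ?addr_ge0 ?normr_ge0 // mulr_ge0 // ltW.
have t2 : 0 <= 4 * C2 * enorm (y a) by rewrite !mulr_ge0 ?enorm_ge0 // ltW.
have al1 : 1 <= al by rewrite /al; lra.
have al0 : 0 < al by exact: lt_le_trans al1.
have al_c : G + 1 <= sg * al * c.
  rewrite mulrAC -ler_pdivrMl ?mulr_gt0 // mulrC /al; lra.
have al_y : 4 * C2 * enorm (y a) <= al by rewrite /al; lra.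
(* As s0 bounds the Bregman distance on the ball of radius R0, K exp(- al rho) >= C2 there. *)
exists al, (C2 * expR (al * s0)); split=> //; first by rewrite mulr_gt0 // expR_gt0.
move=> x xa; rewrite -/(T x) -/(g x).
rewrite -[C2 * _ * _]mulrA -expRD -mulrBr.
set E := expR _; have E0 : 0 < E by exact: expR_gt0.
have bracket : enorm x <= R1 -> 1 <= al * g x + sg * al ^+ 2 * T x.
  move=> xR1.
  have h1 := HG x xR1.
  have h2 : c <= T x by apply: le_trans (FT x); apply: Hc.
  have h3 : sg * al * c <= sg * al * T x by rewrite ler_wpM2l // mulr_ge0 // ltW.
  have : 1 <= al * (g x + sg * al * T x).
    rewrite -[leLHS]mulr1 ler_pM // ; lra.
  by rewrite mulrDr expr2; lra.
have [xR0|xR0] := leP (enorm x) R0.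
  have E1 : 1 <= E.
    rewrite -expR0 ler_expR mulr_ge0 ?subr_ge0 ?(ltW al0) //; exact: Hs0.
  have b1 := bracket (le_trans xR0 R01).
  have := HC2 x xR0.
  have : C2 <= C2 * E * (al * g x + sg * al ^+ 2 * T x).
    by rewrite -mulrA ler_peMr ?(ltW C20) // mulr_ege1.
  lra.
have L1 : 1 <= legendre x by apply: HR0; exact: ltW.
have [xR1|xR1] := leP (enorm x) R1.
  have b1 := bracket xR1.
  have : 0 <= C2 * E * (al * g x + sg * al ^+ 2 * T x).
    by rewrite !mulr_ge0 ?(ltW C20) ?(ltW E0) // (le_trans _ b1).
  lra.
pose s := al * enorm x.
have s1 : al <= s.
  by rewrite /s ler_peMr ?(ltW al0) // (le_trans R1_1) // ltW.
have s0' : 0 < s by exact: lt_le_trans s1.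
have Es : E <= expR (- s).
  rewrite ler_expR /s -mulrN ler_pM2l //.
  have := HC3 x; lra.
(* From E <= exp(- s) and s^2 / 2 <= exp s. *)
have sE : E * s ^+ 2 <= 2.
  have h : s ^+ 2 / 2 <= expR s.
    have := @expR_ge1Dxn R s 1 (ltW s0'); rewrite (_ : 2`! = 2)%N //; lra.
  have : E * expR s <= 1.
    by rewrite -[leRHS](expR0 R) -(addNr s) expRD ler_wpM2r ?expR_ge0.
  have : E * (s ^+ 2 / 2) <= E * expR s by rewrite ler_wpM2l // ltW.
  lra.
have far : C2 * E * (al * (enorm x * enorm (y a))) <= 1 / 2.
  rewrite -(ler_pM2r s0').
  have -> : C2 * E * (al * (enorm x * enorm (y a))) * s =
    (C2 * enorm (y a)) * (E * s ^+ 2) by rewrite /s; ring.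
  have h : 0 <= C2 * enorm (y a) by rewrite mulr_ge0 ?enorm_ge0 // ltW.
  have : (C2 * enorm (y a)) * (E * s ^+ 2) <= (C2 * enorm (y a)) * 2 by rewrite ler_wpM2l.
  lra.
have d1 := dotv_le_enorm x (y a).
have : C2 * E * (al * g x + sg * al ^+ 2 * T x) >= - (C2 * E * (al * (enorm x * enorm (y a)))).
  rewrite -mulrN ler_wpM2l ?mulr_ge0 ?(ltW C20) ?(ltW E0) //.
  have h1 : 0 <= sg * al ^+ 2 * T x by rewrite !mulr_ge0 ?sqr_ge0 // ltW.
  have h2 : - (enorm x * enorm (y a)) <= g x.
    have : 0 <= enorm x * enorm (y a) by rewrite mulr_ge0 ?enorm_ge0.
    by rewrite /g; lra.
  have : al * - (enorm x * enorm (y a)) <= al * g x by rewrite ler_pM2l.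
  lra.
lra.
Qed.

(** * The dilation quotient *)

Definition dilation_quotient x (l : R) := (l ^+ 2 * w x - w (l *: x)) / (l ^+ 2 - 1).

Lemma sqr_sub1_gt0 (l : R) : 1 < l -> 0 < l ^+ 2 - 1.
Proof. by move=> l1; rewrite subr_gt0 expr2 mulr_egt1. Qed.

(** The value q is exactly the one for which g(s) = (w(s x) - q) / s^2 agrees at 1 and l. Rolle's
    theorem applies, since g'(s) = - 2 (phi(s x) - q) / s^3. *)
Lemma dilation_quotient_mean x (l : R) : 1 < l ->
  exists2 xi, 1 < xi < l & dilation_quotient x l = support_value (xi *: x).
Proof.
move=> l1; set q := dilation_quotient x l.
have q1 := sqr_sub1_gt0 l1.
pose f (s : R) := w (0 + s *: x).
have fE s : f s = w (s *: x) by rewrite /f add0r.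
pose g (s : R) := (f s - q) * (s ^+ 2)^-1.
pose dg (s : R) := (f s - q) * (- (2 * s / (s ^+ 2) ^+ 2)) +
  (s ^+ 2)^-1 * dotv x (y (0 + s *: x)).
have g' (s : R) : 1 <= s -> is_derive s 1 g (dg s).
  move=> s1; have s0 : 0 < s := lt_le_trans ltr01 s1.
  have d1 : is_derive s 1 f (dotv x (y (0 + s *: x))) by exact: line_deriv.
  have d1' : is_derive s 1 (fun s => f s - q) (dotv x (y (0 + s *: x))).
    by apply: is_derive_eq; rewrite subr0.
  have d2 := is_derive_sqr s.
  have s20 : s ^+ 2 != 0 by rewrite expf_neq0 // gt_eqF.
  have d3 : is_derive s 1 (fun s : R => (s ^+ 2)^-1) (- (2 * s / (s ^+ 2) ^+ 2)).
    apply: is_derive_eq (is_deriveV (f := fun s : R => s ^+ 2) s20 d2) _.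
    by rewrite /GRing.scale /= mulNr mulrC.
  exact: is_derive_eq (is_deriveM d1' d3) _.
have [||c] := @MVT R g dg 1 l l1.
- by move=> s; rewrite in_itv /= => /andP[s1 _]; apply: g'; exact: ltW.
- apply: continuous_in_subspaceT => s; rewrite inE /= in_itv /= => /andP[s1 _].
  exact: is_derive_continuous (g' s s1).
rewrite in_itv /= => c1l E; exists c => //.
have c0 : 0 < c by case/andP: c1l => c1 _; exact: lt_trans c1.
have c0' : c != 0 by rewrite gt_eqF.
have : dg c * (l - 1) = 0.
  rewrite -E /g !fE scale1r expr1n invr1 mulr1 /q /dilation_quotient.
  field; rewrite !gt_eqF //; exact: lt_trans l1.
move/eqP; rewrite mulf_eq0 subr_eq0 [l == 1]gt_eqF // orbF => /eqP dgc0.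
rewrite /support_value dotvZl -fE.
have : c ^+ 3 * dg c = 0 by rewrite dgc0 mulr0.
have -> : c ^+ 3 * dg c = - 2 * (f c - q) + c * dotv x (y (c *: x)).
  by rewrite /dg add0r; field.
lra.
Qed.

Lemma dilation_quotient_ge0 x l : 1 < l -> 0 <= dilation_quotient x l.
Proof.
by move=> /(dilation_quotient_mean x)[xi _ ->]; exact: support_value_ge0.
Qed.

Lemma dilation_quotient_deriv x (l : R) : 1 < l ->
  is_derive l 1 (dilation_quotient x)
    ((2 * l * (w (l *: x) - w x) - (l ^+ 2 - 1) * dotv x (y (l *: x))) / (l ^+ 2 - 1) ^+ 2).
Proof.
move=> l1; have q1 := sqr_sub1_gt0 l1.
have q1' : l ^+ 2 - 1 != 0 by rewrite gt_eqF.
pose f (s : R) := w (0 + s *: x).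
have d1 : is_derive l 1 f (dotv x (y (l *: x))).
  by rewrite -[X in y X]add0r; exact: line_deriv.
have d2 := is_derive_sqr l.
have d2' : is_derive l 1 (fun s : R => s ^+ 2 - 1) (2 * l).
  by apply: is_derive_eq; rewrite subr0.
have d3 : is_derive l 1 (fun s : R => (s ^+ 2 - 1)^-1) (- (2 * l / (l ^+ 2 - 1) ^+ 2)).
  apply: is_derive_eq (is_deriveV (f := fun s : R => s ^+ 2 - 1) q1' d2') _.
  by rewrite /GRing.scale /= mulNr mulrC.
have d4 : is_derive l 1 (fun s : R => w x * s ^+ 2 - f s)
    (w x * (2 * l) - dotv x (y (l *: x))).
  by apply: is_deriveB; exact: is_deriveZ.
have -> : dilation_quotient x = (fun s : R => w x * s ^+ 2 - f s) * (fun s : R => (s ^+ 2 - 1)^-1).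
  by apply/funext => s; rewrite /dilation_quotient fctE /f add0r [w x * _]mulrC.
apply: is_derive_eq (is_deriveM d4 d3) _.
rewrite /f add0r /GRing.scale /=; field.
exact: q1'.
Qed.

(* The logarithm is a penalty in the time variable: at a minimum point it costs at most
   3 d / 7, which is less than the gain d / 2 due to the barrier. *)
Definition compared (a : 'rV[R]_n) (al K d : R) x (l : R) :=
  dilation_quotient x l + d * (w x - K * expR (- (al * bregman a x))) - d / 7 * ln (l - 1).

(** * Derivatives of [compared] along lines, and absence of minima *)

Section LineDerivatives.
Context (a x v : 'rV[R]_n) (al K d l : R).

Let E (t : R) := expR (- (al * bregman a (x + t *: v))).
Let k1 := l ^+ 2 / (l ^+ 2 - 1).
Let k2 := (l ^+ 2 - 1)^-1.

Lemma bregman_line_deriv (t : R) : is_derive t 1 (fun s => bregman a (x + s *: v))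
  (dotv v (y (x + t *: v) - y a)).
Proof.
pose f (s : R) := dotv (x - a) (y a) + s * dotv v (y a).
have -> : (fun s => bregman a (x + s *: v)) =
  (fun s => w (x + s *: v)) - cst (w a) - f.
  apply/funext => s; rewrite /bregman /f !fctE; congr (_ - _).
  by rewrite [x + _ - a]addrAC (dotvDl _ (x - a)) dotvZl.
have df : is_derive t 1 f (dotv v (y a)).
  have h : is_derive t 1 (fun s : R => dotv v (y a) * s) (dotv v (y a)).
    by apply: is_derive_eq; rewrite /GRing.scale /= mulr1.
  rewrite (_ : f = cst (dotv (x - a) (y a)) + (fun s : R => dotv v (y a) * s)).
    by apply: is_derive_eq; rewrite add0r.
  by apply/funext => s; rewrite /f fctE mulrC.
have dw := line_deriv x v t.
by apply: is_derive_eq; rewrite subr0 dotvBr.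
Qed.

Lemma weight_line_deriv (t : R) :
  is_derive t 1 E (- (al * dotv v (y (x + t *: v) - y a)) * E t).
Proof.
have h : is_derive t 1 (fun s => - (al * bregman a (x + s *: v)))
    (- (al * dotv v (y (x + t *: v) - y a))).
  by apply: is_deriveN; apply: is_deriveZ; exact: bregman_line_deriv.
apply: is_derive_eq (is_derive1_comp (is_derive_expR _) h) _.
by rewrite mulrC.
Qed.

Lemma compared_line_deriv (t : R) :
  is_derive t 1 (fun s => compared a al K d (x + s *: v) l)
    (k1 * dotv v (y (x + t *: v)) - k2 * (l * dotv v (y (l *: x + t *: (l *: v)))) +
     d * (dotv v (y (x + t *: v)) +
          K * al * (dotv v (y (x + t *: v) - y a) * E t))).
Proof.
have -> : (fun s => compared a al K d (x + s *: v) l) =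
  (fun s => k1 * w (x + s *: v)) - (fun s => k2 * w (l *: x + s *: (l *: v))) +
  (fun s => d * (w (x + s *: v) - K * E s)) - cst (d / 7 * ln (l - 1)).
  apply/funext => s; rewrite /compared /dilation_quotient !fctE; congr (_ + _ - _).
  rewrite mulrBl /k1 /k2; congr (_ - _); first by rewrite mulrAC.
  by rewrite [LHS]mulrC scalerDr !scalerA [s * l]mulrC.
have d1 := line_deriv x v t.
have d2 := line_deriv (l *: x) (l *: v) t.
have d3 := weight_line_deriv t.
have d4 : is_derive t 1 (fun s => w (x + s *: v) - K * E s)
   (dotv v (y (x + t *: v)) - K * (- (al * dotv v (y (x + t *: v) - y a)) * E t)).
  by apply: is_deriveB; exact: is_deriveZ.
have e1 : is_derive t 1 (fun s => k1 * w (x + s *: v)) (k1 * dotv v (y (x + t *: v))).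
  exact: is_deriveZ.
have e2 : is_derive t 1 (fun s => k2 * w (l *: x + s *: (l *: v)))
    (k2 * dotv (l *: v) (y (l *: x + t *: (l *: v)))).
  exact: is_deriveZ.
have e3 : is_derive t 1 (fun s => d * (w (x + s *: v) - K * E s))
   (d * (dotv v (y (x + t *: v)) - K * (- (al * dotv v (y (x + t *: v) - y a)) * E t))).
  exact: is_deriveZ.
apply: is_derive_eq; rewrite subr0 dotvZl; ring.
Qed.

Lemma compared_line_deriv2 :
  is_derive (0 : R) 1 (fun t => k1 * dotv v (y (x + t *: v)) -
     k2 * (l * dotv v (y (l *: x + t *: (l *: v)))) +
     d * (dotv v (y (x + t *: v)) +
          K * al * (dotv v (y (x + t *: v) - y a) * E t)))
  (k1 * qform (H x) v - k2 * l ^+ 2 * qform (H (l *: x)) v +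
   d * (qform (H x) v + K * al * expR (- (al * bregman a x)) *
     (qform (H x) v - al * dotv (y x - y a) v ^+ 2))).
Proof.
have f1 := line_deriv2 x v v 0.
have f2 := line_deriv2 (l *: x) (l *: v) v 0.
rewrite scale0r addr0 dotv_hess in f1.
rewrite scale0r addr0 -scalemxAl dotvZr dotv_hess in f2.
have f3 := weight_line_deriv 0.
rewrite {2}/E scale0r addr0 in f3.
have f4 : is_derive (0 : R) 1 (fun t => dotv v (y (x + t *: v) - y a)) (qform (H x) v).
  rewrite (_ : (fun t => _) = (fun t => dotv v (y (x + t *: v))) - cst (dotv v (y a))).
    by apply: is_derive_eq; rewrite subr0.
  by apply/funext => t; rewrite dotvBr !fctE.
have f5 := is_deriveM f4 f3.
rewrite /E !scale0r !addr0 /GRing.scale /= in f5.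
have g1 : is_derive (0 : R) 1 (fun t => k1 * dotv v (y (x + t *: v))) (k1 * qform (H x) v).
  exact: is_deriveZ.
have g2 : is_derive (0 : R) 1 (fun t => k2 * (l * dotv v (y (l *: x + t *: (l *: v)))))
   (k2 * (l * (l * qform (H (l *: x)) v))).
  by apply: is_deriveZ; exact: is_deriveZ.
have g3 : is_derive (0 : R) 1 (fun t => d * (dotv v (y (x + t *: v)) +
          K * al * (dotv v (y (x + t *: v) - y a) * E t)))
  (d * (qform (H x) v + K * al * (dotv v (y x - y a) *
     (- (al * dotv v (y x - y a)) * expR (- (al * bregman a x))) +
     expR (- (al * bregman a x)) * qform (H x) v))).
  by apply: is_deriveZ; apply: is_deriveD => //; exact: is_deriveZ.
have := is_deriveD (is_deriveB g1 g2) g3.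
move=> h; apply: is_derive_eq h _.
rewrite [dotv (y x - y a) v]dotvC; ring.
Qed.

End LineDerivatives.

(** Parabolic minimum principle. At such a minimum the Hessian in x is nonnegative, the radial
    derivative vanishes and the l-derivative is at most 0; with the equation at x and at l x, these
    contradict the barrier inequality. *)
Lemma compared_no_min a x (al K d l : R) : 0 < d -> 1 < l <= 2 ->
  1 / 2 <= K * expR (- (al * bregman a x)) *
    (al * (legendre x - 1 / 2 * dotv x (y a)) +
     sg * al ^+ 2 * dotv ((y x - y a) *m invmx (H x)) ((y x - y a) *m invmx (H x)))
    + legendre x ->
  (forall x', compared a al K d x l <= compared a al K d x' l) ->
  (forall l', 1 < l' <= l -> compared a al K d x l <= compared a al K d x l') ->
  False.
Proof.
move=> d0 /andP[l1 l2]; set E := expR _ => bar minx minl.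
have q1 := sqr_sub1_gt0 l1.
have q1' : l ^+ 2 - 1 != 0 by rewrite gt_eqF.
have l0 : 0 < l - 1 by rewrite subr_gt0.
pose k := l ^+ 2 / (l ^+ 2 - 1).
have k0 : 0 < k by rewrite divr_gt0 // exprn_gt0 // (lt_trans ltr01).
have ek : (l ^+ 2 - 1)^-1 * l ^+ 2 = k by rewrite mulrC.
set p := y x - y a in bar.
pose I := \tr (invmx (H x)); pose I' := \tr (invmx (H (l *: x))).
pose J := \tr (invmx (H x) *m H (l *: x) *m invmx (H x)).
set N := dotv (p *m _) _ in bar.
have hess : 0 <= k * I - k * J + d * (I + K * al * E * (I - al * N)).
  (* The Hessian of [compared] in x; it is traced against H^-2. *)
  pose M := k *: H x - k *: H (l *: x) + d *: (H x + (K * al * E) *: (H x - al *: (p^T *m p))).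
  have M0 v : 0 <= qform M v.
    have := compared_line_deriv2 a x v al K d l.
    rewrite ek -/E -/k -/p => D2.
    have := derive2_min_ge0 (compared_line_deriv a x v al K d l) D2.
    rewrite !(qformD, qformN, qformZ) qform_outer; apply => s.
    by rewrite scale0r addr0.
  have := mxtrace_congr_ge0 (invmx (H x)) M0.
  have trD A B : \tr (invmx (H x) *m (A + B) *m (invmx (H x))^T) =
      \tr (invmx (H x) *m A *m (invmx (H x))^T) + \tr (invmx (H x) *m B *m (invmx (H x))^T).
    by rewrite mulmxDr mulmxDl raddfD.
  have trZ c A : \tr (invmx (H x) *m (c *: A) *m (invmx (H x))^T) =
      c * \tr (invmx (H x) *m A *m (invmx (H x))^T).
    by rewrite -scalemxAr -scalemxAl mxtraceZ.
  have trN A : \tr (invmx (H x) *m (- A) *m (invmx (H x))^T) =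
      - \tr (invmx (H x) *m A *m (invmx (H x))^T).
    by rewrite -scaleN1r trZ mulN1r.
  have trH : \tr (invmx (H x) *m H x *m (invmx (H x))^T) = I.
    by rewrite mulVmx ?posdef_unit // mul1mx mxtrace_tr.
  have trp : \tr (invmx (H x) *m (p^T *m p) *m (invmx (H x))^T) = N.
    rewrite trmx_inv Ht mulmxA -mulmxA.
    have -> : invmx (H x) *m p^T = (p *m invmx (H x))^T by rewrite trmx_mul trmx_inv Ht.
    exact: mxtrace_outer.
  have trJ : \tr (invmx (H x) *m H (l *: x) *m (invmx (H x))^T) = J by rewrite trmx_inv Ht.
  by rewrite /M !(trD, trZ, trN) trH trJ trp.
have conv : 2 * I <= I' + J by exact: mxtrace_inv_convex.
have eI : w x - 1 / 2 * dotv x (y x) = sg * I by exact: (shrinker_eq S).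
have eI' : w (l *: x) - 1 / 2 * (l * dotv x (y (l *: x))) = sg * I'.
  by rewrite -dotvZl; exact: (shrinker_eq S).
have grad0 : k * dotv x (y x) - (l ^+ 2 - 1)^-1 * (l * dotv x (y (l *: x))) +
    d * (dotv x (y x) + K * al * (dotv x p * E)) = 0.
  have := compared_line_deriv a x x al K d l 0.
  rewrite !scale0r !addr0 -/k -/p -/E => D1.
  by apply: (derive_min_eq0 D1) => s; rewrite scale0r addr0.
have dl : (2 * l * (w (l *: x) - w x) - (l ^+ 2 - 1) * dotv x (y (l *: x))) /
   (l ^+ 2 - 1) ^+ 2 - d / 7 * (l - 1)^-1 <= 0.
  apply: (derive_left_min_le0 (g := compared a al K d x) _ l1); last exact: minl.
  have D1 := dilation_quotient_deriv x l1.
  have D2 : is_derive l 1 (fun s : R => d / 7 * ln (s - 1)) (d / 7 * (l - 1)^-1).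
    have h1 : is_derive l 1 (fun s : R => s - 1) 1.
      by apply: is_derive_eq; rewrite subr0.
    have h2 := @is_derive1_comp R (@ln R) (fun s => s - 1) l _ 1 (is_derive1_ln l0) h1.
    rewrite mulr1 in h2.
    exact: (is_deriveZ (d / 7) h2).
  have -> : compared a al K d x = dilation_quotient x +
     cst (d * (w x - K * expR (- (al * bregman a x)))) - (fun s : R => d / 7 * ln (s - 1)).
    by [].
  by apply: is_derive_eq; rewrite addr0.
(* The inequality [dl] multiplied by l (l^2 - 1) / 2. The logarithm then contributes d l (l + 1) /
   14, at most 3 d / 7 because l <= 2. *)
have dl' : k * (w (l *: x) - w x) - 1 / 2 * (l * dotv x (y (l *: x))) <= 3 / 7 * d.
  have c0 : 0 < 1 / 2 * ((l ^+ 2 - 1) * l) by rewrite !mulr_gt0 // (lt_trans ltr01).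
  have := dl; rewrite -(pmulr_rle0 _ c0) => h.
  have e1 : 1 / 2 * ((l ^+ 2 - 1) * l) * ((2 * l * (w (l *: x) - w x) -
     (l ^+ 2 - 1) * dotv x (y (l *: x))) / (l ^+ 2 - 1) ^+ 2 - d / 7 * (l - 1)^-1) =
     k * (w (l *: x) - w x) - 1 / 2 * (l * dotv x (y (l *: x))) - d / 14 * (l * (l + 1)).
    by rewrite /k; field; rewrite q1' gt_eqF.
  rewrite e1 in h.
  have : d * (l * (l + 1)) <= d * 6.
    rewrite ler_pM2l //; have : l * (l + 1) <= 2 * 3 by rewrite ler_pM //; lra.
    lra.
  lra.
rewrite /legendre in bar.
have dp : dotv x p = dotv x (y x) - dotv x (y a) by rewrite dotvBr.
rewrite dp in grad0.
have kl : k * (l * dotv x (y (l *: x))) - (l ^+ 2 - 1)^-1 * (l * dotv x (y (l *: x))) =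
   l * dotv x (y (l *: x)).
  by rewrite /k; field.
move: hess conv eI eI' grad0 dl' bar kl.
set X := dotv x (y x); set X' := l * dotv x (y (l *: x)); set Z := dotv x (y a).
set w0 := w x; set w1 := w (l *: x); set k2 := (l ^+ 2 - 1)^-1.
move=> hess conv eI eI' grad0 dl' bar kl.
(* Multiplication by [sg] lets the equation replace the traces I and I'; J is removed by
   convexity. *)
have h1 : 0 <= k * (sg * I - sg * J) + d * (sg * I + K * al * E * (sg * I - al * (sg * N))).
  have -> : k * (sg * I - sg * J) + d * (sg * I + K * al * E * (sg * I - al * (sg * N))) =
    sg * (k * I - k * J + d * (I + K * al * E * (I - al * N))) by ring.
  by rewrite mulr_ge0 // ltW.
have h2 : k * (sg * I - sg * J) <= k * (sg * I' - sg * I).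
  rewrite ler_pM2l //.
  have : sg * (2 * I) <= sg * (I' + J) by rewrite ler_pM2l.
  lra.
rewrite -eI -eI' in h1 h2.
have h3 : d * (1 / 2) <= d * (K * E * (al * (X - w0 - 1 / 2 * Z) + sg * al ^+ 2 * N) + (X - w0)).
  by rewrite ler_pM2l.
(* Matches d times the barrier with the d-terms of [h1] and half those of [grad0]; what remains is d
   / 2 <= 3 d / 7. *)
have e3 : d * (K * E * (al * (X - w0 - 1 / 2 * Z) + sg * al ^+ 2 * N) + (X - w0)) =
  - (d * (w0 - 1 / 2 * X + K * al * E * (w0 - 1 / 2 * X - al * (sg * N))))
  + 1 / 2 * (d * (X + K * al * ((X - Z) * E))) by field.
lra.
Qed.

(** * Comparison principle for the dilation quotient *)

Lemma compared_continuous a (al K d : R) (p : 'rV[R]_n * R) : 1 < p.2 ->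
  {for p, continuous (fun p => compared a al K d p.1 p.2)}.
Proof.
move=> p1; have q1 := sqr_sub1_gt0 p1.
have c1 : {for p, continuous (fun p : 'rV[R]_n * R => p.1)} by exact: cvg_fst.
have c2 : {for p, continuous (fun p : 'rV[R]_n * R => p.2)} by exact: cvg_snd.
have cw1 : {for p, continuous (fun p : 'rV[R]_n * R => w p.1)}.
  by apply: continuous_comp c1 _; exact: (shrinker_cont S).
have cw2 : {for p, continuous (fun p : 'rV[R]_n * R => w (p.2 *: p.1))}.
  apply: (@continuous_comp _ _ _ (fun p : 'rV[R]_n * R => p.2 *: p.1) w).
    by apply: cvgZ; [exact: c2|exact: c1].
  exact: (shrinker_cont S).
have cl2 : {for p, continuous (fun p : 'rV[R]_n * R => p.2 ^+ 2)}.
  exact: (continuousM c2 c2).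
have cl3 : {for p, continuous (fun p : 'rV[R]_n * R => p.2 ^+ 2 - 1)}.
  exact: (continuousB cl2 (@cst_continuous _ _ (1 : R) _)).
have cq : {for p, continuous (fun p : 'rV[R]_n * R => dilation_quotient p.1 p.2)}.
  have c := continuousB (continuousM cl2 cw1) cw2.
  exact (continuousM c (continuousV (s := fun p : 'rV[R]_n * R => p.2 ^+ 2 - 1)
    (lt0r_neq0 q1) cl3)).
have cb : {for p, continuous (fun p : 'rV[R]_n * R => bregman a p.1)}.
  by apply: continuous_comp c1 _; exact: bregman_continuous.
have cE : {for p, continuous (fun p : 'rV[R]_n * R => expR (- (al * bregman a p.1)))}.
  apply: (@continuous_comp _ _ _ (fun p : 'rV[R]_n * R => - (al * bregman a p.1)) expR).
    exact: (continuousN (continuousM (@cst_continuous _ _ al _) cb)).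
  exact: continuous_expR.
have cs : {for p, continuous (fun p : 'rV[R]_n * R => p.2 - 1)}.
  exact: (continuousB c2 (@cst_continuous _ _ (1 : R) _)).
have cln : {for p, continuous (fun p : 'rV[R]_n * R => ln (p.2 - 1))}.
  apply: (@continuous_comp _ _ _ (fun p : 'rV[R]_n * R => p.2 - 1) (@ln R) _ cs).
  by apply: continuous_ln; rewrite subr_gt0.
have cwE := continuousB cw1 (continuousM (@cst_continuous _ _ K _) cE).
exact: (continuousB (continuousD cq (continuousM (@cst_continuous _ _ d _) cwE))
  (continuousM (@cst_continuous _ _ (d / 7) _) cln)).
Qed.

(** For each d > 0, the quotient minus m plus d times a coercive barrier and a logarithmic penalty
    is shown to be nonnegative; then d tends to 0. A negative value would force a minimum in a
    compact set, away from [a], which [compared_no_min] excludes. *)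
Lemma dilation_quotient_comparison a r m l2 : 0 < r -> 1 < l2 <= 2 ->
  (forall x l, enorm (x - a) < r -> 1 < l <= l2 -> m <= dilation_quotient x l) ->
  forall x l, 1 < l <= l2 -> m <= dilation_quotient x l.
Proof.
move=> r0 /andP[l21 l22] near.
have [al [K [al0 K0 bar]]] := barrier a r0.
have [|C HC] := superlinear (P := 1); first by [].
(* This constant makes b nonnegative and coercive. *)
pose be := K + `|C|.
pose b x := be + (w x - K * expR (- (al * bregman a x))).
have b_low x : enorm x - C + `|C| <= b x.
  have h : expR (- (al * bregman a x)) <= 1.
    by rewrite -expR0 ler_expR oppr_le0 mulr_ge0 ?(ltW al0) ?bregman_ge0.
  have h' : K * expR (- (al * bregman a x)) <= K * 1 by rewrite ler_pM2l.
  have := HC x; rewrite /b /be; lra.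
have b0 x : 0 <= b x.
  have := b_low x; have := enorm_ge0 x; have := ler_norm C; lra.
have lnN l : 1 < l <= l2 -> 0 <= - ln (l - 1).
  by move=> /andP[l1 ll2]; rewrite oppr_ge0 ln_le0 //; lra.
suff key d x l : 0 < d -> 1 < l <= l2 -> 0 <= compared a al K d x l + (d * be - m).
  move=> x l ll; rewrite leNgt; apply/negP => qm.
  have c0 : 0 < b x - ln (l - 1) / 7 + 1.
    have := lnN _ ll; have := b0 x; lra.
  (* With this d, the correction terms amount to less than half of the supposed gap m - q. *)
  pose d := (m - dilation_quotient x l) / (2 * (b x - ln (l - 1) / 7 + 1)).
  have d0 : 0 < d by rewrite divr_gt0 ?subr_gt0 // mulr_gt0.
  have := key d x l d0 ll.
  have -> : compared a al K d x l + (d * be - m) = dilation_quotient x l - m +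
     d * (b x - ln (l - 1) / 7 + 1) - d.
    by rewrite /compared /b; field.
  have -> : d * (b x - ln (l - 1) / 7 + 1) = (m - dilation_quotient x l) / 2.
    rewrite /d; move: c0; move: (b x - ln (l - 1) / 7 + 1) => B B0.
    by field; rewrite gt_eqF.
  lra.
move=> d0 ll; rewrite leNgt; apply/negP => neg.
have cE x' l' : compared a al K d x' l' + (d * be - m) =
    dilation_quotient x' l' - m + d * b x' + d / 7 * - ln (l' - 1).
  by rewrite /compared /b; field.
(* For l' < l1 the logarithmic penalty alone exceeds |m|; for |x'| > R1 the barrier term does. *)
pose l1 := 1 + expR (- (7 * `|m| / d)).
have l11 : 1 < l1 by rewrite ltrDl expR_gt0.
pose R1 := `|m| / d + `|C|.
have d7 : 0 < d / 7 by rewrite divr_gt0.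
have in_A x' l' : 1 < l' <= l2 -> compared a al K d x' l' + (d * be - m) < 0 ->
    enorm x' <= R1 /\ l1 <= l' <= l2.
  move=> ll'; rewrite cE => hneg; have q0 := dilation_quotient_ge0 x' (andP ll').1.
  have h1 := lnN _ ll'; have h2 := b0 x'.
  have h3 : 0 <= d / 7 * - ln (l' - 1) by rewrite mulr_ge0 // ltW.
  have h4 : 0 <= d * b x' by rewrite mulr_ge0 // ltW.
  have hm := ler_norm m.
  split.
    have : d * b x' <= `|m| by lra.
    rewrite mulrC -ler_pdivlMr // /R1.
    have := b_low x'; have := ler_norm C; have := normr_ge0 C; lra.
  apply/andP; split; last by case/andP: ll'.
  have : d / 7 * - ln (l' - 1) <= `|m| by lra.
  rewrite mulrC -ler_pdivlMr // lerNl => h5.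
  have : expR (- (`|m| / (d / 7))) <= l' - 1.
    rewrite -[leRHS]lnK ?ler_expR // posrE subr_gt0; by case/andP: ll'.
  have -> : `|m| / (d / 7) = 7 * `|m| / d by field; rewrite gt_eqF.
  rewrite /l1; lra.
pose A := [set p : 'rV[R]_n * R | enorm p.1 <= R1 /\ l1 <= p.2 <= l2].
have A0 : A (x, l).
  by have [h1 h2] := in_A x l ll neg; split.
have cA : compact A.
  have := compact_setX (@enorm_ball_compact R n R1) (@segment_compact R l1 l2).
  congr compact; apply/seteqP; split=> -[x'' l''] /= [h1 h2]; split => //;
    by move: h2; rewrite /= in_itv.
have [||[x' l'] + hmin] := @compact_EVT_min _ _ (fun p => compared a al K d p.1 p.2) A _ cA.
- by exists (x, l).
- apply: continuous_in_subspaceT => p; rewrite inE => -[_].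
  move=> /andP[pl _]; apply: compared_continuous.
  exact: lt_le_trans pl.
rewrite inE => -[/= xA' lA].
have ll' : 1 < l' <= l2.
  by case/andP: lA => h1 ->; rewrite andbT; exact: lt_le_trans h1.
have neg' : compared a al K d x' l' + (d * be - m) < 0.
  apply: le_lt_trans neg; rewrite lerD2r.
  by have := hmin (x, l); rewrite inE => /(_ A0).
have gmin x'' l'' : 1 < l'' <= l2 -> compared a al K d x' l' <= compared a al K d x'' l''.
  move=> ll''; have [h|h] := leP 0 (compared a al K d x'' l'' + (d * be - m)).
    by have := lt_le_trans neg' h; rewrite ltrD2r => /ltW.
  have [h1 h2] := in_A _ _ ll'' h.
  by have := hmin (x'', l''); rewrite inE; apply.
have far : r <= enorm (x' - a).
  rewrite leNgt; apply/negP => h; have := near _ _ h ll'.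
  have h3 : 0 <= d / 7 * - ln (l' - 1) by rewrite mulr_ge0 ?lnN // ltW.
  have h4 : 0 <= d * b x' by rewrite mulr_ge0 // ltW.
  move: neg'; rewrite cE; lra.
apply: (compared_no_min (l := l') d0 _ (bar x' far)).
- by case/andP: ll' => -> h; rewrite (le_trans h).
- by move=> x''; exact: gmin.
- move=> l'' /andP[h1 h2]; apply: gmin; rewrite h1 (le_trans h2) //.
  by case/andP: ll'.
Qed.

(** * Constancy of phi and homogeneity *)

(** By continuity and the mean value form, the quotient is at least phi(a) - eta near [a] for l
    close to 1. The comparison extends this to every x, and l tends to 1. *)
Lemma support_value_le a x : support_value a <= support_value x.
Proof.
apply/ler_addgt0Pl => eta eta0; rewrite -lerBlDl.
have near_a : \forall z \near a, support_value a - eta <= support_value z.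
  move/cvgrPdist_le : (support_value_continuous (x := a)) => /(_ _ eta0).
  apply: filterS => z; rewrite ler_norml => /andP[_]; lra.
have /nbhs_ballP[r /= r0 Hr] := near_a.
(* Then r1 <= 1 and r1 |a| <= r / 3, so |a - xi z| <= |1 - xi| |a| + 2 |z - a| < r for the points
   used below. *)
pose r1 := r / (3 * (1 + enorm a + r)).
have den0 : 0 < 3 * (1 + enorm a + r).
  by rewrite mulr_gt0 // ltr_pwDr // addr_ge0 ?enorm_ge0.
have r10 : 0 < r1 by rewrite divr_gt0.
have r11 : r1 <= 1.
  by rewrite ler_pdivrMr // mul1r; have := enorm_ge0 a; lra.
have r1r : r1 * (1 + enorm a + r) = r / 3.
  by rewrite /r1; field; rewrite gt_eqF // ltr_pwDr // addr_ge0 ?enorm_ge0.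
have quot z l : enorm (z - a) < r / 3 -> 1 < l <= 1 + r1 ->
    support_value a - eta <= dilation_quotient z l.
  move=> za /andP[l1 lr].
  have [xi /andP[xi1 xil] ->] := dilation_quotient_mean z l1.
  apply: Hr; rewrite -ball_normE /=.
  have -> : a - xi *: z = (1 - xi) *: a - xi *: (z - a).
    by rewrite scalerBr scalerBl scale1r opprB addrA subrK.
  apply: (le_lt_trans (ler_normB _ _)); rewrite !normrZ.
  have h1 : `|1 - xi| <= r1 by rewrite ler_norml; apply/andP; split; lra.
  have h2 : `|xi| <= 2 by rewrite ger0_norm; lra.
  have h3 : `|1 - xi| * `|a| <= r1 * enorm a by rewrite ler_pM // norm_le_enorm.
  have h4 : `|xi| * `|z - a| <= 2 * enorm (z - a) by rewrite ler_pM // norm_le_enorm.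
  have h5 : r1 * enorm a <= r / 3.
    rewrite -r1r ler_pM2l //; lra.
  lra.
have r30 : 0 < r / 3 by rewrite divr_gt0.
have l2 : 1 < 1 + r1 <= 2 by apply/andP; split; lra.
have comp := dilation_quotient_comparison r30 l2 quot.
rewrite leNgt; apply/negP => lt_x.
have cx : {for (1 : R), continuous (fun s : R => support_value (s *: x))}.
  apply: (@continuous_comp _ _ _ (fun s : R => s *: x) support_value).
    exact: scalel_continuous.
  exact: support_value_continuous.
have [e /= e0 He] : \forall s \near (1 : R), support_value (s *: x) < support_value a - eta.
  move/cvgr_lt : cx; apply; by rewrite /= scale1r.
pose l := 1 + Num.min r1 e / 2.
have m0 : 0 < Num.min r1 e by rewrite lt_min r10.
have m1 : Num.min r1 e <= r1 by rewrite ge_min lexx.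
have m2 : Num.min r1 e <= e by rewrite ge_min lexx orbT.
have l1 : 1 < l by rewrite ltrDl divr_gt0.
have ll : 1 < l <= 1 + r1 by rewrite l1 /l lerD2l; lra.
have [xi /andP[xi1 xil] Exi] := dilation_quotient_mean x l1.
have := comp x l ll; rewrite Exi leNgt => /negP; apply; apply: He.
rewrite /ball /= distrC gtr0_norm ?subr_gt0 //.
rewrite /l in xil; lra.
Qed.

(** As phi is constant, f(s) = w(s x) satisfies f - s f' / 2 = c. Hence s f'' = f', f'' is constant
    on ]0, 1], and continuity of [H] identifies it with its value at 0. *)
Lemma convex_shrinker_quadratic x :
  w x = sg * \tr (invmx (H 0)) + 1 / 2 * qform (H 0) x.
Proof.
pose c := support_value 0.
have const z : support_value z = c by apply/eqP; rewrite eq_le !support_value_le.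
have c0 : c = w 0 by rewrite /c /support_value dotv0l mulr0 subr0.
have <- : c = sg * \tr (invmx (H 0)) by exact: (shrinker_eq S).
pose f (s : R) := w (0 + s *: x).
pose f1 (s : R) := dotv x (y (0 + s *: x)).
pose f2 (s : R) := qform (H (0 + s *: x)) x.
have df (s : R) : is_derive s 1 f (f1 s) by exact: line_deriv.
have df1 (s : R) : is_derive s 1 f1 (f2 s).
  by rewrite /f2 -dotv_hess; exact: line_deriv2.
have eqc s : f s - 1 / 2 * (s * f1 s) = c.
  by rewrite /f /f1 -(const (s *: x)) /support_value add0r dotvZl.
have eqd s : s * f2 s = f1 s.
  have h : is_derive s 1 (fun s : R => s * f1 s) (s * f2 s + f1 s).
    apply: is_derive_eq (is_deriveM (is_derive_id s 1) (df1 s)) _.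
    by rewrite /GRing.scale /= mulr1.
  have h1 : is_derive s 1 (fun s => f s - 1 / 2 * (s * f1 s))
      (f1 s - 1 / 2 * (s * f2 s + f1 s)).
    by apply: is_deriveB; exact: (is_deriveZ (1 / 2) h).
  have h2 : is_derive s 1 (fun s => f s - 1 / 2 * (s * f1 s)) 0.
    rewrite (_ : (fun s => _) = cst c); first exact: is_derive_cst.
    exact/funext.
  have := @derive_val _ _ _ _ _ _ _ h1; rewrite (@derive_val _ _ _ _ _ _ _ h2); lra.
(* Homogeneity: (f - c) / s^2 is constant on ]0, +oo[. *)
have f2E s : 0 < s <= 1 -> f2 s = f2 1.
  move=> /andP[s0 s1].
  pose g (t : R) := (f t - c) * (t ^+ 2)^-1.
  have g' (t : R) : 0 < t -> is_derive t 1 g 0.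
    move=> t0; have t20 : t ^+ 2 != 0 by rewrite expf_neq0 // gt_eqF.
    have d1 : is_derive t 1 (fun s => f s - c) (f1 t).
      by apply: is_derive_eq; rewrite subr0.
    have d2 := is_deriveV (f := fun s : R => s ^+ 2) t20 (is_derive_sqr t).
    apply: is_derive_eq (is_deriveM d1 d2) _.
    have := eqc t => e1; have -> : f t - c = 1 / 2 * (t * f1 t) by lra.
    rewrite /GRing.scale /=; field; exact: lt0r_neq0.
  have [||t1 _ E] := @MVT_segment R g (cst 0) s 1 s1.
  - by move=> t; rewrite in_itv /= => /andP[st _]; apply: g'; exact: lt_trans st.
  - apply: continuous_in_subspaceT => t; rewrite inE /= in_itv /= => /andP[st _].
    by apply: is_derive_continuous (g' t _); exact: lt_le_trans st.
  have e2 t : 0 < t -> g t = 1 / 2 * f2 t.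
    move=> t0; rewrite /g; have := eqc t => e1.
    have -> : f t - c = 1 / 2 * (t * f1 t) by lra.
    by rewrite -eqd; field; exact: lt0r_neq0.
  by move: E; rewrite mul0r !e2 //; lra.
have cf2 : {for (0 : R), continuous f2}.
  rewrite (_ : f2 = (fun s => \sum_i \sum_j x 0 i * H (0 + s *: x) i j * x 0 j)).
    apply: continuous_bigsum => i; apply: continuous_bigsum => j s.
    have h : {for s, continuous (fun s : R => H (0 + s *: x) i j)}.
      apply: (@continuous_comp _ _ _ (fun s : R => 0 + s *: x) (fun z => H z i j)).
        rewrite (_ : (fun s : R => 0 + s *: x) = *:%R^~ x); first exact: scalel_continuous.
        by apply/funext => t; rewrite add0r.
      exact: (shrinker_hess_cont S).
    exact (continuousM (continuousM (@cst_continuous _ _ (x 0 i : R) s) h)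
      (@cst_continuous _ _ (x 0 j : R) s)).
  by apply/funext => s; rewrite /f2 qform_sum.
have f20 : f2 0 = f2 1.
  apply/eqP; rewrite -subr_eq0 -normr_le0; apply/ler_addgt0Pl => eps eps0.
  rewrite addr0.
  move/cvgrPdist_le : cf2 => /(_ _ eps0) [e /= e0 He].
  pose s := Num.min (e / 2) 1.
  have s0 : 0 < s by rewrite lt_min divr_gt0 // ltr01.
  have s1 : s <= 1 by rewrite ge_min lexx orbT.
  have se : s <= e / 2 by rewrite ge_min lexx.
  rewrite -(f2E s) ?s0 //; apply: He.
  rewrite /ball /= sub0r normrN gtr0_norm //; lra.
have e1 := eqc 1; rewrite mul1r -(eqd 1) mul1r -f20 in e1.
rewrite /f /f2 scale0r addr0 scale1r add0r in e1; lra.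
Qed.

End ConvexShrinker.

Lemma is_derive_bigsum (R : realType) (V : normedModType R) (I : Type) (s : seq I)
  (F : I -> V -> R) (dF : I -> R) (x v : V) :
  (forall i, is_derive x v (F i) (dF i)) ->
  is_derive x v (fun z => \sum_(i <- s) F i z) (\sum_(i <- s) dF i).
Proof.
move=> dFE; elim: s => [|i s IH].
  rewrite big_nil (_ : (fun z => _) = cst 0); first exact: is_derive_cst.
  by apply/funext => z; rewrite big_nil.
rewrite big_cons (_ : (fun z => _) = F i + (fun z => \sum_(j <- s) F j z)).
  exact: is_deriveD.
by apply/funext => z; rewrite big_cons fctE.
Qed.

(** * Reduction to the convex case *)

Section SquareRow.
Context {R : realType} {n : nat}.
Implicit Types (x v c : 'rV[R]_n).

Lemma is_derive_coord i x v : is_derive x v (fun z : 'rV[R]_n => z 0 i) (v 0 i).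
Proof.
pose q (h : R) := h^-1 *: (((fun z : 'rV[R]_n => z 0 i) \o shift x) (h *: v) - x 0 i).
suff cv : q h @[h --> 0^'] --> (v 0 i : R).
  by split; [apply/cvg_ex; exists (v 0 i)|exact: cvg_lim cv].
apply: (@cvg_trans _ ((cst (v 0 i) : R -> R) @ 0^')); last exact: cvg_cst.
apply: near_eq_cvg; near=> h.
have h0 : h != 0 by near: h; exact: nbhs_dnbhs_neq.
by rewrite /q /= !mxE addrK /GRing.scale /= mulKf.
Unshelve. all: by end_near. Qed.

Lemma is_derive_dotv_self x v :
  is_derive x v (fun z => dotv z z) (2 * dotv v x).
Proof.
rewrite /dotv mulr_sumr; apply: is_derive_bigsum => i.
have h := is_derive_coord i x v.
by apply: is_derive_eq (is_deriveM h h) _; rewrite /GRing.scale /=; ring.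
Qed.

End SquareRow.

Section ReductionToConvex.
Context {R : realType} {n : nat} {u : 'rV[R]_n -> R}.
Context (u_C2 : is_Ck 2 u).
Implicit Types (x v c : 'rV[R]_n).

Let uc : continuous u. Proof. by case: u_C2. Qed.
Let up i x : derivable u x (delta_mx 0 i).
Proof. by case: u_C2 => _ /(_ i)[]. Qed.
Let upc i : continuous (partial i u).
Proof. by case: u_C2 => _ /(_ i)[_ []]. Qed.
Let upp i j x : derivable (partial j u) x (delta_mx 0 i).
Proof. by case: u_C2 => _ /(_ j)[_ [_ /(_ i)[]]]. Qed.
Let uppc i j : continuous (partial i (partial j u)).
Proof. by case: u_C2 => _ /(_ j)[_ [_ /(_ i)[_ []]]]. Qed.

Lemma C2_deriv x v : is_derive x v u (dotv v (grad u x)).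
Proof.
have -> : dotv v (grad u x) = \sum_i v 0 i * partial i u x.
  by apply: eq_bigr => i _; rewrite mxE.
by apply: (@is_derive_row _ _ u (fun i => partial i u)) => // i z; exact: derivableP.
Qed.

Lemma C2_deriv2 c x v :
  is_derive x v (fun z => dotv c (grad u z)) (dotv c (v *m hessian u x)).
Proof.
apply: is_derive_bigsum => i.
have -> : (fun z => c 0 i * grad u z 0 i) = (fun z => c 0 i * partial i u z).
  by apply/funext => z; rewrite mxE.
apply: is_deriveZ.
have -> : (v *m hessian u x) 0 i = \sum_j v 0 j * partial j (partial i u) x.
  by rewrite mxE; apply: eq_bigr => j _; rewrite mxE.
by apply: (@is_derive_row _ _ (partial i u) (fun j => partial j (partial i u))) => // j z;
  exact: derivableP.
Qed.

Lemma hessian_sym x : (hessian u x)^T = hessian u x.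
Proof.
apply/matrixP => i j; rewrite !mxE.
by apply: (@mixed_derive_eq _ _ u (partial j u) (partial i u)
  (partial j (partial i u)) (partial i (partial j u)) x (delta_mx 0 j) (delta_mx 0 i));
  (try by move=> z; exact: derivableP); exact: uppc.
Qed.

Context (sg s : R) (lambda : 'rV[R]_n -> 'I_n -> R).
Context (n_gt0 : (0 < n)%N).
Context (sg_gt0 : 0 < sg).
Context (ss1 : s * s = 1).
Context (lambdaP : forall x, eigenvalues_of (hessian u x) (lambda x)).
Context (u_eq : forall x, - sg * (\sum_(i < n) 1 / (1 + lambda x i)) =
     - u x + 1 / 2 * dotv x (grad u x)).
Context (s_posdef : forall x, posdef (s *: (hessian u x + 1%:M))).

(** The eigenvalues of the matrix are s (1 + lambda_i), and 1 / s = s. *)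
Lemma mxtrace_inv_shifted_hessian x :
  \tr (invmx (s *: (hessian u x + 1%:M))) = s * \sum_(i < n) 1 / (1 + lambda x i).
Proof.
have s0 : s != 0 by apply/eqP => s0; move: ss1; rewrite s0 mul0r => /eqP; rewrite eq_sym oner_eq0.
rewrite (@mxtrace_invmx _ _ _ (fun i => s * (1 + lambda x i))) //.
- rewrite mulr_sumr; apply: eq_bigr => i _; rewrite invfM mul1r; congr (_ * _).
  by apply: (mulfI s0); rewrite ss1 divff.
- exact: posdef_unit.
move=> t.
have -> : t%:M - s *: (hessian u x + 1%:M) = s *: ((s * t - 1)%:M - hessian u x).
  rewrite scalerBr scale_scalar_mx mulrBr mulrA ss1 mul1r mulr1.
  by rewrite raddfB /= scalerDr scalemx1 opprD addrA addrAC.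
rewrite detZ -char_poly_horner lambdaP horner_prod -[n in s ^+ n]card_ord.
rewrite -prodr_const -big_split; apply: eq_bigr => i _ /=.
by rewrite hornerXsubC -[X in X - s * (_ + _)]mul1r -ss1; ring.
Qed.

(** The sign [s] covers both cases. The added |x|^2 / 2, homogeneous of degree 2, drops out of w -
    <x, Dw> / 2, so both sides of the equation are just multiplied by [s]. *)
Lemma convex_shrinker_of_C2 : convex_shrinker sg
  (fun x => s * (u x + 1 / 2 * dotv x x)) (fun x => s *: (grad u x + x))
  (fun x => s *: (hessian u x + 1%:M)).
Proof.
have dd x v := is_derive_dotv_self x v.
split => //.
- move=> x v; rewrite dotvZr; apply: is_deriveZ.
  have h : is_derive x v (fun z => 1 / 2 * dotv z z) (1 / 2 * (2 * dotv v x)).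
    exact: is_deriveZ.
  apply: is_derive_eq (is_deriveD (C2_deriv x v) h) _.
  by rewrite dotvDr; field.
- move=> c x v.
  have -> : (fun z => dotv c (s *: (grad u z + z))) =
     (fun z => s * (dotv c (grad u z) + dotv c z)).
    by apply/funext => z; rewrite dotvZr dotvDr.
  rewrite -scalemxAr mulmxDr mulmx1 dotvZr dotvDr.
  apply: is_deriveZ; apply: is_deriveD; first exact: C2_deriv2.
  by apply: is_derive_bigsum => i; apply: is_deriveZ; exact: is_derive_coord.
- have cd : continuous (fun x : 'rV[R]_n => dotv x x).
    by apply: dotv_continuous => i; exact: coord_continuous.
  move=> x; exact (continuousM (@cst_continuous _ _ s x)
    (continuousD (uc (x := x)) (continuousM (@cst_continuous _ _ (1 / 2 : R) x) (cd x)))).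
- move=> i x.
  rewrite (_ : (fun z => _) = (fun z => s * (partial i u z + z 0 i))); last first.
    by apply/funext => z; rewrite !mxE.
  exact (continuousM (@cst_continuous _ _ s x)
    (continuousD (upc (x := x)) (@coord_continuous _ _ _ 0 i x))).
- move=> i j x.
  rewrite (_ : (fun z => _) = (fun z => s * (partial i (partial j u) z + (1%:M : 'M[R]_n) i j)));
    last by apply/funext => z; rewrite !mxE.
  exact (continuousM (@cst_continuous _ _ s x)
    (continuousD (uppc (x := x)) (@cst_continuous _ _ ((1%:M : 'M[R]_n) i j) x))).
- by move=> x; rewrite linearZ linearD /= hessian_sym trmx1.
- move=> x; rewrite mxtrace_inv_shifted_hessian dotvZr dotvDr (mulrCA sg).
  have -> : sg * (\sum_(i < n) 1 / (1 + lambda x i)) =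
    u x - 1 / 2 * dotv x (grad u x) by have := u_eq x; lra.
  by field.
Qed.

Lemma C2_shrinker_quadratic x :
  u x = sg * (\sum_(i < n) 1 / (1 + lambda 0 i)) + 1 / 2 * qform (hessian u 0) x.
Proof.
have s0 : s != 0 by apply/eqP => s0; move: ss1; rewrite s0 mul0r => /eqP; rewrite eq_sym oner_eq0.
have := convex_shrinker_quadratic convex_shrinker_of_C2 x.
rewrite mxtrace_inv_shifted_hessian qformZ qformD qform1 => h.
apply: (mulfI s0); lra.
Qed.

End ReductionToConvex.

Local Close Scope classical_set_scope.
Unset Implicit Arguments.
Set Strict Implicit.
Set Printing Implicit Defensive.

Theorem theorem1p1 (R : realType) (n : nat) (hn : (1 <= n)%N)
  (u : 'rV[R]_n -> R) (lambda : 'rV[R]_n -> 'I_n -> R)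
  (u_C2 : is_Ck 2 u)
  (lambdaP : forall x : 'rV[R]_n, eigenvalues_of (hessian u x) (lambda x))
  (u_eq : forall x : 'rV[R]_n,
     - Num.sqrt 2 * (\sum_(i < n) 1 / (1 + lambda x i)) =
     - u x + 1 / 2 * dotv x (grad u x))
  (u_hess : (forall x : 'rV[R]_n, loewner_lt (- 1%:M) (hessian u x)) \/
            (forall x : 'rV[R]_n, loewner_lt (hessian u x) (- 1%:M))) :
  quadratic_polynomial u /\
  exists (A : 'M[R]_n) (lbar : 'I_n -> R),
    [/\ A^T = A,
        eigenvalues_of A lbar &
        forall x : 'rV[R]_n,
          u x = Num.sqrt 2 * (\sum_(i < n) 1 / (1 + lbar i))
                + 1 / 2 * qform A x].
Proof.
have sg0 : 0 < Num.sqrt 2 :> R by rewrite sqrtr_gt0.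
have uE x : u x = Num.sqrt 2 * (\sum_(i < n) 1 / (1 + lambda 0 i))
    + 1 / 2 * qform (hessian u 0) x.
  (* The sign is 1 when the Hessian lies above -I and -1 when it lies below. *)
  case: u_hess => u_hess.
    apply: (C2_shrinker_quadratic (s := 1) u_C2) => //; first by rewrite mulr1.
    by move=> z v v0; rewrite scale1r; have := u_hess z v v0; rewrite opprK.
  apply: (C2_shrinker_quadratic (s := - 1) u_C2) => //; first by rewrite mulrNN mulr1.
  by move=> z v v0; rewrite scaleN1r opprD addrC; exact: u_hess.
split; last by exists (hessian u 0), (lambda 0); split; [exact: hessian_sym| |].
have [p [sz_p pE]] := QuadraticForms.quadratic_polynomial_form
  (Num.sqrt 2 * (\sum_(i < n) 1 / (1 + lambda 0 i))) ((1 / 2) *: hessian u 0).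
by exists p; split=> // x; rewrite -pE -qform_sum qformZ; exact: uE.
Qed.
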